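(* Let $n \ge 5$ and let $\alpha = \frac{6n-37-\sqrt{24n+1}}{18}$. Among all connected graphs of order $n$ whose adjacency matrix has rank $5$, the graph attaining the minimum spectral radius is: (i) $G_7 = C_5$ if $n = 5$; (ii) $G_1 \circ (1,1,1,1,n-4)$ if $6 \le n \le 10$; (iii) $G_{10} \circ (1,1,1,1,1,n-5)$ if $n = 11$; (iv) $G_{10} \circ (1,1,1,1,k,n-k-4)$ with $k = \lfloor \alpha \rfloor$ or $k = \lceil \alpha \rceil$, if $n \ge 12$.
   Context: For a graph $G$, $A(G)$ is its adjacency matrix, the rank of $G$ is the rank of $A(G)$, and $\rho(G)$ is the largest eigenvalue of $A(G)$. Multiplication of vertices: if $G$ has vertices $v_1,\dots,v_k$ and $\mathbf{m}=(n_1,\dots,n_k)$ is a vector of positive integers, $G\circ\mathbf{m}$ is the graph obtained by replacing each $v_i$ by an independent set $V_i$ of $n_i$ vertices and joining every vertex of $V_i$ to every vertex of $V_j$ if and only if $v_iv_j \in E(G)$ (no other edges). The graphs used: $G_1$ has vertices $v_1,\dots,v_5$ and edges $v_1v_2, v_1v_3, v_1v_4, v_2v_4, v_3v_5$ (a triangle $v_1v_2v_4$ with a pendant path $v_1v_3v_5$). $G_7$ is the 5-cycle $v_1v_2v_3v_4v_5v_1$. $G_{10}$ has vertices $v_1,\dots,v_6$ and edges $v_1v_2, v_1v_3, v_1v_4, v_2v_3, v_2v_5, v_3v_5, v_4v_6$. *)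

(* Defs.v *)
From HB Require Import structures.
From mathcomp Require Import all_boot all_order all_algebra.
From mathcomp Require Import classical_sets reals.
From mathcomp Require complex polyrcf.

Set Implicit Arguments.
Unset Strict Implicit.
Unset Printing Implicit Defensive.

Import Order.TTheory GRing.Theory Num.Theory.

Local Open Scope ring_scope.

Record sgraph := SGraph {
  vertex :> finType;
  adj : rel vertex;
  adj_sym : symmetric adj;
  adj_irrefl : irreflexive adj
}.

Definition sg_connected (G : sgraph) : Prop :=
  forall x y : G, connect (@adj G) x y.

Definition sg_iso (G H : sgraph) : Prop :=
  exists2 f : G -> H, bijective f & forall x y, adj (f x) (f y) = adj x y.

Section Spectrum.
Variable R : realType.

Definition adjacency (G : sgraph) : 'M[R]_#|G| :=
  \matrix_(i, j) (adj (enum_val i) (enum_val j))%:R.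

Definition graph_rank (G : sgraph) : nat := \rank (adjacency G).

(* The spectrum is a finite set, so this supremum is the largest eigenvalue;
   see [spectral_radius_max]. *)
Definition spectral_radius (G : sgraph) : R :=
  sup [set a : R | eigenvalue (adjacency G) a]%classic.

Section Max.
Import complex polyrcf.

Lemma adjacency_eigenvalue_exists (G : sgraph) :
  (0 < #|G|)%N -> exists a : R, eigenvalue (adjacency G) a.
Proof.
move=> G_gt0; set A := adjacency G; pose f := real_complex R.
have [z /eigenvalueP[v vAz v0]] :=
  @eigenvalue_closed (complex R) _ (map_mx f A) G_gt0.
pose vc := map_mx (@Num.conj (complex R)) v.
have symA : (map_mx f A)^T = map_mx f A.
  by apply/matrixP => i j; rewrite !mxE adj_sym.
have conjA : map_mx (@Num.conj (complex R)) (map_mx f A) = map_mx f A.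
  by apply/matrixP => i j; rewrite !mxE /f !rmorph_nat.
have vcAz : vc *m map_mx f A = z^* *: vc.
  by rewrite -{1}conjA -map_mxM vAz map_mxZ.
have zz : z *: (v *m vc^T) = z^* *: (v *m vc^T).
  by rewrite scalemxAl -vAz -mulmxA -{1}symA -trmx_mul vcAz linearZ scalemxAr.
have N0 : (v *m vc^T) 0 0 != 0.
  rewrite mxE psumr_neq0 => [|i _]; last by rewrite !mxE mul_conjC_ge0.
  have [i vi] : exists i, v 0 i != 0 by apply/rV0Pn.
  by apply/hasP; exists i; rewrite ?mem_index_enum // !mxE mul_conjC_gt0.
move/matrixP/(_ 0 0): zz; rewrite !(mxE scalemx_key) => /(mulIf N0)/esym/CrealP zR.
exists (complex.Re z); rewrite -(eigenvalue_map f).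
by rewrite /f /= RRe_real //; apply/eigenvalueP; exists v.
Qed.

Lemma spectral_radius_max (G : sgraph) : (0 < #|G|)%N ->
  eigenvalue (adjacency G) (spectral_radius G) /\
  forall a : R, eigenvalue (adjacency G) a -> a <= spectral_radius G.
Proof.
move=> G_gt0; have [a0 a0P] := adjacency_eigenvalue_exists G_gt0.
rewrite /spectral_radius; set A := adjacency G in a0P *.
have p0 : char_poly A != 0 by rewrite monic_neq0 ?char_poly_monic.
have rtsE a : eigenvalue A a = (a \in rootsR (char_poly A)).
  rewrite eigenvalue_root_char.
  by have := roots_on_rootsR p0 a; rewrite in_itv /= => ->.
pose b := \big[Num.max/a0]_(a <- rootsR (char_poly A)) a.
have bP : eigenvalue A b.
  rewrite /b big_seq; elim/big_rec: _ => // a x aP xP.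
  by case: (leP a x); rewrite // rtsE.
have b_max a : eigenvalue A a -> a <= b.
  by rewrite rtsE => aP; rewrite /b; apply: le_bigmax_seq aP _.
suff -> : sup [set a : R | eigenvalue A a]%classic = b by split.
apply/eqP; rewrite eq_le; apply/andP; split.
  by apply: ge_sup; [exists a0 | move=> a /b_max].
by apply: ub_le_sup => //; exists b => a /b_max.
Qed.

End Max.

End Spectrum.

(* [multiply G m] is $G \circ m$: vertex $i$ of [G] becomes the fibre of [i], an
   independent set of [m i] vertices. Intended for positive [m] only: when
   [m i = 0] the vertex $i$ is deleted. *)
Section Multiplication.
Variables (G : sgraph) (m : G -> nat).

Definition mult_adj : rel {i : G & 'I_(m i)} := fun u v => adj (tag u) (tag v).

Lemma mult_adj_sym : symmetric mult_adj.
Proof. by move=> u v; exact: adj_sym. Qed.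

Lemma mult_adj_irrefl : irreflexive mult_adj.
Proof. by move=> u; exact: adj_irrefl. Qed.

Definition multiply : sgraph := SGraph mult_adj_sym mult_adj_irrefl.

End Multiplication.

Arguments multiply : clear implicits.

Section EdgeList.
Variables (k : nat) (es : seq (nat * nat)).

(* Vertices are numbered from 1 in [es], so $v_i$ is the ordinal $i - 1$. *)
Definition edge_adj : rel 'I_k := fun i j =>
  (i != j) && (((i.+1, j.+1) \in es) || ((j.+1, i.+1) \in es)).

Lemma edge_adj_sym : symmetric edge_adj.
Proof. by move=> i j; rewrite /edge_adj eq_sym orbC. Qed.

Lemma edge_adj_irrefl : irreflexive edge_adj.
Proof. by move=> i; rewrite /edge_adj eqxx. Qed.

Definition edge_graph : sgraph := SGraph edge_adj_sym edge_adj_irrefl.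

End EdgeList.

Definition G1 := edge_graph 5 [:: (1, 2); (1, 3); (1, 4); (2, 4); (3, 5)]%N.

Definition G7 := edge_graph 5 [:: (1, 2); (2, 3); (3, 4); (4, 5); (5, 1)]%N.

Definition G10 :=
  edge_graph 6 [:: (1, 2); (1, 3); (1, 4); (2, 3); (2, 5); (3, 5); (4, 6)]%N.

Definition conn_rank5 (R : realType) (n : nat) (G : sgraph) : Prop :=
  [/\ #|G| = n, sg_connected G & graph_rank R G = 5].

(* [H] is, up to isomorphism, the only graph attaining the minimum. *)
Definition the_minimizer (R : realType) (n : nat) (H : sgraph) : Prop :=
  [/\ conn_rank5 R n H,
      forall G, conn_rank5 R n G -> spectral_radius R H <= spectral_radius R G
    & forall G, conn_rank5 R n G -> spectral_radius R G = spectral_radius R H ->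
        sg_iso G H].

Definition alpha (R : realType) (n : nat) : R :=
  (6 * n%:R - 37 - Num.sqrt (24 * n%:R + 1)) / 18.

(* Main.v *)
Require Import Defs.
From mathcomp Require Import all_boot all_order all_algebra.
From mathcomp Require Import reals.
From mathcomp Require Import ring lra zify.
From mathcomp Require complex spectral.

Set Implicit Arguments.
Unset Strict Implicit.
Unset Printing Implicit Defensive.

Import Order.TTheory GRing.Theory Num.Theory.
Local Open Scope ring_scope.

(* Let [t] be the spectral radius of a connected graph of order [n] and rank 5.

   Five vertices carry a nonsingular principal submatrix [B] of the adjacency
   matrix, and the adjacency of two vertices is the value of the form [B^-1] on
   the vectors of their adjacencies to these five.  If every vertex has two
   neighbours among the five, counting walks of length 2 gives
   [5 t^2 >= 4 n + 3] for [n >= 6].  Otherwise the five can be exchanged for an edge [v i] and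
   a triangle [a b c] having no vertex adjacent to [v].  If the neighbours of [v]
   are not all twins of [i], the form leaves so few possibilities that
   [5 t^2 >= 4 n + 3] again follows from walks of length 2.  If they are twins of
   [i], the graph is a complete tripartite graph plus a class [C] of twins and a
   class [L] of vertices with neighbourhood [C]; summing the eigenvalue equation
   of a Perron vector over the classes gives
   [(t^2 - l - 1) ((t^2 - t) / 2 - k - 1) >= 1] when [C] and two of the parts are
   singletons ([l = |L|], [n = k + l + 4]), with equality only for
   G10 o (1,1,1,1,k,l), and [3 t^2 - t > 2 n + 1/2] otherwise.

   As the two factors have sum [(3 t^2 - t) / 2 - n + 2], the best real [k] makes
   both equal to 1, so that [3 t^2 - t = 2 n] and [k = alpha]; for the best
   integer [k] the spectral radius satisfies [3 t^2 - t < 2 n + 1/2] for [n >= 7],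
   and floor and ceiling cannot tie because the golden ratio is irrational.
   G1 o (1,1,1,1,l) is the case [k = 0] of this family. *)

(** * Perron vectors *)

Section Rayleigh.
Import complex spectral.
Local Open Scope sesquilinear_scope.

(** In a unitary eigenbasis of the complexified matrix the form is a sum of [d 0 i * |w_i|^2], and
    each [d 0 i] is a real eigenvalue of [A]. *)
Lemma rayleigh_le (R : realType) n (A : 'M[R]_n) (rho : R) (y : 'rV[R]_n) :
  A^T = A -> (forall a, eigenvalue A a -> a <= rho) ->
  (y *m A *m y^T) 0 0 <= rho * (y *m y^T) 0 0.
Proof.
move=> symA rho_max; pose f := real_complex R.
have fr m k (M : 'M[R]_(m, k)) : map_mx (@Num.conj (complex R)) (map_mx f M) = map_mx f M.
  by apply/matrixP => i j; rewrite !mxE; apply/conj_Creal; rewrite complex_real.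
pose B := map_mx f A.
have hB : B \is hermsymmx.
  by apply/is_hermitianmxP; rewrite expr0 scale1r /B map_trmx symA fr.
have /orthomx_spectralP EB := hermitian_normalmx hB.
have Pu := spectral_unitarymx B; have Pun := spectral_unit B.
have := hermitian_spectral_diag_real hB.
set P := spectralmx B in EB Pu Pun *; set d := spectral_diag B in EB * => dR.
have iP : invmx P = P^t* by exact: invmx_unitary.
have d_le i : d 0 i <= f rho.
  have /RRe_real drE := mxOverP dR 0 i.
  rewrite -[d 0 i]drE lecR; apply: rho_max.
  rewrite -(eigenvalue_map f) -/B; apply/eigenvalueP; exists (row i P).
    rewrite -row_mul EB !mulmxA mulmxV // mul1mx row_mul.
    rewrite row_diag_mx -scalemxAl -rowE; congr (_ *: _).
    exact: (esym drE).
  apply/eqP => Pi0; have /row_free_inj : row_free P by rewrite row_free_unit.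
  move=> /(_ 1 (delta_mx 0 i) 0).
  rewrite -rowE Pi0 mul0mx => /(_ erefl)/matrixP/(_ 0 i).
  by rewrite !mxE !eqxx => /eqP; rewrite oner_eq0.
pose yc := map_mx f y; pose w := yc *m P^t*.
have wt : w^t* = P *m yc^T.
  by rewrite /w trmx_mul map_mxM trmxCK -map_trmx fr map_trmx.
have E1 : yc *m B *m yc^T = w *m diag_mx d *m w^t*.
  by rewrite wt EB iP /w !mulmxA.
have E2 : yc *m yc^T = w *m w^t*.
  by rewrite wt /w -iP -!mulmxA (mulmxA _ P) mulVmx // mul1mx.
suff: f ((y *m A *m y^T) 0 0) <= f (rho * (y *m y^T) 0 0) by rewrite lecR.
rewrite [f (rho * _)](_ : _ = f rho * f ((y *m y^T) 0 0)); last exact: rmorphM.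
have -> : f ((y *m A *m y^T) 0 0) = (yc *m B *m yc^T) 0 0.
  rewrite /yc map_trmx -!map_mxM. by rewrite [RHS]mxE.
have -> : f ((y *m y^T) 0 0) = (yc *m yc^T) 0 0.
  by rewrite /yc map_trmx -!map_mxM [RHS]mxE.
rewrite E1 E2 !mxE mulr_sumr; apply: ler_sum => i _.
rewrite mul_mx_diag !mxE -mulrA mulrCA; apply: ler_wpM2r; last exact: d_le.
exact: mul_conjC_ge0.
Qed.
End Rayleigh.

Section Perron.
Variables (R : realType) (G : sgraph).

Definition nbr_sum (f : G -> R) (u : G) : R := \sum_(w | adj u w) f w.

Lemma nbr_sumE f u : nbr_sum f u = \sum_w (adj u w)%:R * f w.
Proof.
rewrite /nbr_sum big_mkcond; apply: eq_bigr => w _.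
by case: adj; rewrite ?mul1r ?mul0r.
Qed.

Lemma sum_nbr_sumC (f g : G -> R) :
  \sum_u f u * nbr_sum g u = \sum_u nbr_sum f u * g u.
Proof.
under eq_bigr do rewrite nbr_sumE mulr_sumr.
rewrite exchange_big; apply: eq_bigr => u _.
rewrite nbr_sumE mulr_suml; apply: eq_bigr => w _.
by rewrite adj_sym mulrCA mulrA.
Qed.

Let rowf (f : G -> R) : 'rV[R]_#|G| := \row_i f (enum_val i).

Let sum_enum (F : G -> R) : \sum_u F u = \sum_(i < #|G|) F (enum_val i).
Proof. by rewrite -(big_enum_val (A := G)); apply: eq_bigl. Qed.

Let rowfM f : rowf f *m adjacency R G = rowf (nbr_sum f).
Proof.
apply/rowP => j; rewrite !mxE nbr_sumE sum_enum.
by apply: eq_bigr => i _; rewrite !mxE mulrC adj_sym.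
Qed.

Lemma adjacency_eigenvalueP a :
  reflect (exists2 f : G -> R, exists u, f u != 0
             & forall u, nbr_sum f u = a * f u)
          (eigenvalue (adjacency R G) a).
Proof.
apply: (iffP eigenvalueP) => [[v vA v0]|[f [u fu0] fA]].
  have vE : v = rowf (fun u => v 0 (enum_rank u)).
    by apply/rowP => i; rewrite mxE enum_valK.
  exists (fun u => v 0 (enum_rank u)).
    have [i vi] := rV0Pn _ v0.
    by exists (enum_val i); rewrite enum_valK.
  move=> u; move: vA; rewrite {1}vE rowfM => /rowP/(_ (enum_rank u)).
  by rewrite !mxE enum_rankK.
exists (rowf f); first by rewrite rowfM; apply/rowP => i; rewrite !mxE fA.
by apply/rV0Pn; exists (enum_rank u); rewrite mxE enum_rankK.
Qed.

Lemma sum_mul_nbr_sum_le (f : G -> R) : (0 < #|G|)%N ->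
  \sum_u f u * nbr_sum f u <= spectral_radius R G * \sum_u f u ^+ 2.
Proof.
move=> G0; have [_ rmax] := spectral_radius_max R G0.
have symA : (adjacency R G)^T = adjacency R G.
  by apply/matrixP => i j; rewrite !mxE adj_sym.
have := rayleigh_le (rowf f) symA rmax.
rewrite rowfM !mxE !sum_enum.
congr (_ <= _ * _); apply: eq_bigr => i _; rewrite !mxE ?expr2 //.
by rewrite mulrC.
Qed.

Lemma linear_term_eq0 (b d : R) : (forall t, 0 <= t * b + t ^+ 2 * d) -> b = 0.
Proof.
move=> H; apply/eqP/negPn/negP => b0; pose k := `|d| + 1.
have k0 : 0 < k by rewrite ltr_wpDl.
have dk : d < k by rewrite (le_lt_trans (ler_norm _)) // ltrDl.
have := H (- b / k); rewrite leNgt => /negP[].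
have -> : - b / k * b + (- b / k) ^+ 2 * d = b ^+ 2 * (d - k) / k ^+ 2.
  by field; rewrite gt_eqF.
rewrite pmulr_llt0 ?invr_gt0 ?exprn_gt0 //.
by rewrite pmulr_rlt0 ?subr_lt0 // lt_def sqrf_eq0 b0 sqr_ge0.
Qed.

(** A maximizer of the Rayleigh quotient is a critical point: perturbing [x] at [u] alone gives a
    nonnegative quadratic in [t] without constant term, whose linear coefficient must vanish. *)
Lemma rayleigh_max_eigenvector (x : G -> R) : (0 < #|G|)%N ->
  spectral_radius R G * \sum_u x u ^+ 2 <= \sum_u x u * nbr_sum x u ->
  forall u, nbr_sum x u = spectral_radius R G * x u.
Proof.
move=> G0; set r := spectral_radius R G => xmax u.
have xE : \sum_u x u * nbr_sum x u = r * \sum_u x u ^+ 2.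
  by apply/eqP; rewrite eq_le xmax sum_mul_nbr_sum_le.
apply/esym/eqP; rewrite -subr_eq0; apply/eqP.
suff: 2 * (r * x u - nbr_sum x u) = 0 by lra.
apply: (@linear_term_eq0 _ r) => t.
pose e w : R := (w == u)%:R.
have sE (g : G -> R) : \sum_w e w * g w = g u.
  rewrite (bigD1 u) //= /e eqxx mul1r big1 ?addr0 // => w /negPf ->.
  by rewrite mul0r.
have := sum_mul_nbr_sum_le (fun w => x w + t * e w) G0; rewrite -/r.
have nD w : nbr_sum (fun w => x w + t * e w) w = nbr_sum x w + t * nbr_sum e w.
  by rewrite /nbr_sum big_split mulr_sumr.
have -> : \sum_w (x w + t * e w) * nbr_sum (fun w => x w + t * e w) w =
          \sum_w x w * nbr_sum x w + 2 * t * nbr_sum x u.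
  under eq_bigr do rewrite nD mulrDl !mulrDr.
  rewrite !big_split /=.
  under [X in _ + X + _]eq_bigr do rewrite mulrCA.
  under [X in _ + (X + _)]eq_bigr do rewrite -mulrA.
  under [X in _ + (_ + X)]eq_bigr do rewrite -mulrA mulrCA.
  rewrite -!mulr_sumr (sum_nbr_sumC x e).
  under [X in _ + t * X + _]eq_bigr do rewrite mulrC.
  rewrite !sE.
  have -> : nbr_sum e u = 0.
    by rewrite /nbr_sum big1 // => w uw; rewrite /e; case: eqP uw => // ->;
       rewrite adj_irrefl.
  by ring.
have -> : \sum_w (x w + t * e w) ^+ 2 =
          \sum_w x w ^+ 2 + 2 * t * x u + t ^+ 2.
  under eq_bigr => w _.
    have -> : (x w + t * e w) ^+ 2 =
       x w ^+ 2 + 2 * t * (e w * x w) + t ^+ 2 * (e w * e w) by ring.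
    over.
  by rewrite !big_split /= -!mulr_sumr !sE /e eqxx mulr1.
by rewrite xE; lra.
Qed.

(** Absolute values do not lower the Rayleigh quotient of a top eigenvector, so they form an
    eigenvector again; its zero set is closed under adjacency, hence empty. *)
Lemma perron : (0 < #|G|)%N -> sg_connected G ->
  exists2 x : G -> R, forall u, 0 < x u
    & forall u, nbr_sum x u = spectral_radius R G * x u.
Proof.
move=> G0 conG; have [/adjacency_eigenvalueP[z [u0 zu0] zA] _] :=
  spectral_radius_max R G0.
pose x u := `|z u|.
have xA : forall u, nbr_sum x u = spectral_radius R G * x u.
  apply: rayleigh_max_eigenvector => //.
  have -> : \sum_u x u ^+ 2 = \sum_u z u ^+ 2.
    by apply: eq_bigr => u _; rewrite /x real_normK ?num_real.
  rewrite mulr_sumr; apply: ler_sum => u _.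
  rewrite expr2 mulrCA -zA (le_trans (ler_norm _)) // normrM.
  by apply: ler_wpM2l => //; exact: ler_norm_sum.
exists x => // u; rewrite lt_def normr_ge0 andbT; apply/negP => xu0.
pose Z := [pred w | x w == 0].
have clZ : closed (@adj G) Z.
  suff H u1 w : adj u1 w -> x u1 = 0 -> x w = 0.
    move=> u1 w uw; rewrite !inE; apply/eqP/eqP; first exact: H.
    by apply: H; rewrite adj_sym.
  move=> uw xu; have /eqP := xA u1; rewrite xu mulr0.
  rewrite psumr_eq0 => [/allP/(_ w)|*]; last exact: normr_ge0.
  by rewrite mem_index_enum uw => /(_ isT)/eqP.
have := closed_connect clZ (conG u u0).
by rewrite !inE xu0 normr_eq0 (negPf zu0).
Qed.

(** In matrix terms [|A y| <= rho |y|]. For counting vectors [y] the left side counts walks of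
    length 2. *)
Lemma sum_sqr_nbr_sum_le (y : G -> R) : (0 < #|G|)%N -> sg_connected G ->
  \sum_u nbr_sum y u ^+ 2 <= spectral_radius R G ^+ 2 * \sum_u y u ^+ 2.
Proof.
move=> G0 conG; have [x x0 xA] := perron G0 conG.
set r := spectral_radius R G in xA *.
(* Schur's test with the Perron vector as weight. *)
have CS u : nbr_sum y u ^+ 2 <= nbr_sum x u * nbr_sum (fun w => y w ^+ 2 / x w) u.
  set T := nbr_sum y u; set S := nbr_sum x u; set Q := nbr_sum _ u.
  have [u1 uu1|nu] := pickP (adj u); last first.
    by rewrite /T /Q /nbr_sum !(eq_bigl _ _ nu) !big_pred0_eq mulr0 expr0n.
  have S0 : 0 < S.
    rewrite /S /nbr_sum (bigD1 u1) //= ltr_pwDl //.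
    by apply: sumr_ge0 => w _; exact: ltW.
  have : 0 <= \sum_(w | adj u w) (S * y w - T * x w) ^+ 2 / x w.
    by apply: sumr_ge0 => w _; rewrite divr_ge0 ?sqr_ge0 // ltW.
  have -> : \sum_(w | adj u w) (S * y w - T * x w) ^+ 2 / x w =
            S * (S * Q - T ^+ 2).
    under eq_bigr => w _.
      have -> : (S * y w - T * x w) ^+ 2 / x w =
          S ^+ 2 * (y w ^+ 2 / x w) - 2 * S * T * y w + T ^+ 2 * x w.
        by field; rewrite gt_eqF.
      over.
    rewrite big_split /= sumrB -!mulr_sumr.
    by rewrite -/(nbr_sum _ u) -/Q -/(nbr_sum y u) -/T -/(nbr_sum x u) -/S; ring.
  by rewrite pmulr_rge0 // subr_ge0.
have r0 : 0 <= r.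
  have [u _] : exists u : G, true by case/card_gt0P: G0 => u _; exists u.
  have : 0 <= r * x u by rewrite -xA; apply: sumr_ge0 => w _; exact: ltW.
  by rewrite pmulr_lge0.
apply: le_trans (_ : \sum_u r * (x u * nbr_sum (fun w => y w ^+ 2 / x w) u) <= _).
  by apply: ler_sum => u _; rewrite mulrA -xA.
rewrite -mulr_sumr sum_nbr_sumC expr2 -mulrA; apply: ler_wpM2l => //.
rewrite mulr_sumr; apply: ler_sum => u _; rewrite xA.
by rewrite -mulrA (mulrC (x u)) divfK // gt_eqF.
Qed.
End Perron.

(** * Nonsingular principal submatrices *)

Section Rank.
Variables (R : realType) (G : sgraph) (r : nat).
Implicit Types h : 'I_r -> G.

(** Phrased by linear relations, so that concrete cases are left to linear arithmetic; injectivity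
    of [h] follows. *)
Definition nonsingular_on h := forall z : 'I_r -> R,
  (forall i, \sum_j z j * (adj (h j) (h i))%:R = 0) -> forall j, z j = 0.

Definition spans_rows h := forall u, exists z : 'I_r -> R,
  forall w, (adj u w)%:R = \sum_j z j * (adj (h j) w)%:R.

Let A := adjacency R G.
Let rows h := rowsub (fun i => enum_rank (h i)) A.

Let rowsE h i j : rows h i j = (adj (h i) (enum_val j))%:R.
Proof. by rewrite !mxE enum_rankK. Qed.

Let rows_free h : nonsingular_on h -> row_free (rows h).
Proof.
move=> nd; apply: inj_row_free => v vh0; apply/rowP => j; rewrite mxE.
apply: (nd (fun j => v 0 j)) => i.
move/rowP/(_ (enum_rank (h i))): vh0; rewrite [LHS]mxE [RHS]mxE => vh.
rewrite -[RHS]vh; by apply: eq_bigr => k _; rewrite rowsE enum_rankK.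
Qed.

Lemma nonsingular_inj h : nonsingular_on h -> injective h.
Proof.
move=> nd i j hij; apply/eqP/negPn/negP => ij.
have := nd (fun k => (k == i)%:R - (k == j)%:R) _ i.
rewrite eqxx (negPf ij) subr0 => nd'.
suff: 1 = 0 :> R by move/eqP; rewrite oner_eq0.
apply: nd' => k.
rewrite (bigD1 i) //= (bigD1 j) 1?eq_sym //= big1 => [|l /andP[/negPf-> /negPf->]].
  by rewrite !eqxx (eq_sym j) (negPf ij) hij; ring.
by rewrite subr0 mul0r.
Qed.

(** The [r] rows of [h] are independent already on the columns of [h], and the rank is [r]. *)
Lemma nonsingular_spans h :
  graph_rank R G = r -> nonsingular_on h -> spans_rows h.
Proof.
move=> rkG nd u.
have sub : (A <= rows h)%MS.
  rewrite -(mxrank_leqif_sup (rowsub_sub _ _)) -/(rows h).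
  by rewrite (eqP (rows_free nd)) -rkG.
have /submxP[z zE] := submx_trans (row_sub (enum_rank u) A) sub.
exists (fun j => z 0 j) => w; move/rowP/(_ (enum_rank w)): zE.
rewrite [LHS]mxE [LHS]mxE !enum_rankK [RHS]mxE => ->.
by apply: eq_bigr => k _; rewrite rowsE enum_rankK.
Qed.

Lemma graph_rank_eq h : nonsingular_on h -> spans_rows h -> graph_rank R G = r.
Proof.
move=> nd sp; rewrite /graph_rank -/A -(eqP (rows_free nd)).
apply/eqP; rewrite eqn_leq !mxrankS ?rowsub_sub //.
apply/row_subP => i; have [z zE] := sp (enum_val i).
apply/submxP; exists (\row_j z j); apply/rowP => j; rewrite [LHS]mxE [LHS]mxE zE [RHS]mxE.
by apply: eq_bigr => k _; rewrite rowsE mxE.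
Qed.

(** In a symmetric matrix, rows forming a basis of the row space select a nonsingular principal
    submatrix. *)
Lemma nonsingular_exists :
  graph_rank R G = r -> exists h, nonsingular_on h.
Proof.
rewrite /graph_rank -/A => rkG; pose f := maxrankfun A.
have fP : row_free (rowsub f A) := maxrowsub_free A.
have fE : (A <= rowsub f A)%MS by rewrite (eq_maxrowsub A).
move: f fP fE; rewrite rkG => f fP fE.
have [C CE] := submxP fE.
have symA : A^T = A by apply/matrixP => i j; rewrite !mxE adj_sym.
exists (fun i => enum_val (f i)) => z z0 j.
have zv i : \sum_k z k * A (f k) i = 0.
  (* By symmetry the chosen columns span all columns, so a relation between the rows on the chosen
     columns holds on every column. *)
  have -> : A = (rowsub f A)^T *m C^T by rewrite -trmx_mul -CE symA.
  under eq_bigr do rewrite mxE mulr_sumr.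
  rewrite exchange_big big1 //= => l _.
  under eq_bigr do rewrite mulrA.
  rewrite -mulr_suml [X in X * _](_ : _ = 0) ?mul0r //.
  rewrite -[RHS](z0 l); apply: eq_bigr => k _; congr (_ * _).
  by rewrite !mxE adj_sym.
have := row_free_inj fP (m := 1) (x1 := \row_k z k) (x2 := 0).
rewrite mul0mx => /(_ _)/rowP/(_ j); rewrite !mxE; apply.
apply/rowP => i; rewrite !mxE -[RHS](zv i).
by apply: eq_bigr => k _; rewrite !mxE.
Qed.

End Rank.

(** * Frames: an edge and a triangle *)

Definition pendant_triangle (G : sgraph) (i v a b c : G) :=
  [&& adj v i, ~~ adj v a, ~~ adj v b, ~~ adj v c, adj a b, adj a c & adj b c].

Lemma big_tnth5 (R : realType) (T : Type) (p q s t u : T) (z : 'I_5 -> R)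
    (F : T -> R) :
  \sum_j z j * F (tnth [tuple p; q; s; t; u] j) =
  z 0 * F p + z 1 * F q + z 2 * F s + z 3 * F t + z 4 * F u.
Proof.
rewrite !big_ord_recl big_ord0 addr0 !addrA.
by do 4?[congr (_ + _)]; congr (z _ * F _); rewrite ?(tnth_nth p) //; apply/val_inj.
Qed.

(* The signature of [u] on the frame [i, v, a, b, c] is its five adjacency bits;
   [t] records which of [a, b, c] are adjacent to [i].  [frame_form] is twice
   the bilinear form [x B^-1 y], with [B] the adjacency matrix of the frame. *)
Definition frame_form (ta tb tc : bool) (x y : bool * bool * bool * bool * bool) : int :=
  let: (xi, xv, xa, xb, xc) := x in
  let: (yi, yv, ya, yb, yc) := y in
  let ea := xa%:Z - ta%:Z * xv%:Z in
  let eb := xb%:Z - tb%:Z * xv%:Z in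
  let ec := xc%:Z - tc%:Z * xv%:Z in
  let za := eb + ec - ea in
  let zb := ea + ec - eb in
  let zc := ea + eb - ec in
  2 * xv%:Z * yi%:Z
  + (2 * xi%:Z - ta%:Z * za - tb%:Z * zb - tc%:Z * zc) * yv%:Z
  + za * ya%:Z + zb * yb%:Z + zc * yc%:Z.

Section Config.
Variables (R : realType) (G : sgraph) (i v a b c : G).

Definition signature (u : G) := (adj u i, adj u v, adj u a, adj u b, adj u c).

(** Column [v] kills the coefficient of [i], the triangle columns then kill those of [a], [b], [c],
    and column [i] that of [v]. *)
Lemma pendant_triangle_nonsingular : pendant_triangle i v a b c ->
  nonsingular_on R (tnth [tuple i; v; a; b; c]).
Proof.
case/and5P=> vi /negPf va /negPf vb /negPf vc /and3P[ab ac bc] z zE.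
pose B (x y : G) : R := (adj x y)%:R.
have E k : \sum_j z j * B (tnth [tuple i; v; a; b; c] j) k =
    z 0 * B i k + z 1 * B v k + z 2 * B a k + z 3 * B b k + z 4 * B c k.
  exact: (big_tnth5 i v a b c z (fun u => B u k)).
have := zE 4; have := zE 3; have := zE 2; have := zE 1; have := zE 0.
rewrite /= !(E _) /B !(tnth_nth i) /= !adj_irrefl.
rewrite !(adj_sym _ v) vi va vb vc (adj_sym b a) (adj_sym c a) (adj_sym c b).
rewrite ab ac bc !(adj_sym _ i) /= => E0 E1 E2 E3 E4 j.
have z0 : z 0 = 0 by lra.
have z2 : z 2 = 0 by rewrite z0 in E2 E3 E4; lra.
have z3 : z 3 = 0 by rewrite z0 in E2 E3 E4; lra.
have z4 : z 4 = 0 by rewrite z0 in E2 E3 E4; lra.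
have z1 : z 1 = 0 by rewrite z0 z2 z3 z4 in E0; lra.
case: j => [[|[|[|[|[|//]]]]] Hj].
- by rewrite -[RHS]z0; congr z; apply/val_inj.
- by rewrite -[RHS]z1; congr z; apply/val_inj.
- by rewrite -[RHS]z2; congr z; apply/val_inj.
- by rewrite -[RHS]z3; congr z; apply/val_inj.
- by rewrite -[RHS]z4; congr z; apply/val_inj.
Qed.

Hypothesis rk5 : graph_rank R G = 5.
Hypothesis cfg : pendant_triangle i v a b c.

(** The row of [u] is a combination of the frame rows, with coefficients determined by the signature
    of [u]; the factor 2 clears the denominator in the inverse of the triangle. *)
Lemma adj_frame_form u w :
  2 * (adj u w)%:Z ==
  frame_form (adj i a) (adj i b) (adj i c) (signature u) (signature w).
Proof.
have [z zE] := nonsingular_spans rk5 (pendant_triangle_nonsingular cfg) u.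
case/and5P: cfg => vi /negPf va /negPf vb /negPf vc /and3P[ab ac bc].
pose B (x y : G) : R := (adj x y)%:R.
have E k : B u k =
    z 0 * B i k + z 1 * B v k + z 2 * B a k + z 3 * B b k + z 4 * B c k.
  rewrite /B zE; exact: (big_tnth5 i v a b c z (fun u => B u k)).
apply/eqP; apply: (@intr_inj R); move: (E w) (E i) (E v) (E a) (E b) (E c).
rewrite /frame_form /signature /B !(adj_sym w).
rewrite !(rmorphD, rmorphB, rmorphN, rmorphM, rmorph_nat) /= -!pmulrn.
rewrite !adj_irrefl !(adj_sym _ v) vi va vb vc (adj_sym b a) (adj_sym c a) (adj_sym c b).
rewrite ab ac bc !(adj_sym _ i) /= => -> -> -> -> -> ->.
ring.
Qed.
End Config.

(** * Bounds from walks of length 2 *)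

Section Hubs.
Variables (R : realType) (G : sgraph).
Hypotheses (conG : sg_connected G) (G0 : (0 < #|G|)%N).
Let rho : R := spectral_radius R G.

Lemma sum_count_mem (T : finType) (F : T -> nat) (s : seq T) :
  (\sum_u count_mem u s * F u = \sum_(x <- s) F x)%N.
Proof.
elim: s => [|x s IH]; first by rewrite big_nil big1.
rewrite big_cons -IH (bigD1 x) //= [in RHS](bigD1 x) //= eqxx mulnDl mul1n addnA.
congr (_ + _)%N; apply: eq_bigr => u /negPf.
by rewrite eq_sym => ->.
Qed.

(* [s] may list a vertex several times, so it stands for a weighted set. *)
Lemma sum_sqr_count_adj_le (s : seq G) :
  (\sum_u count (adj u) s ^ 2)%:R <=
    rho ^+ 2 * (\sum_(x <- s) count_mem x s)%:R.
Proof.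
have := sum_sqr_nbr_sum_le (fun u => (count_mem u s)%:R : R) G0 conG.
congr (_ <= _ * _).
  rewrite natr_sum; apply: eq_bigr => u _; rewrite natrX; congr (_ ^+ 2).
  rewrite nbr_sumE; under eq_bigr do rewrite -natrM.
  rewrite -natr_sum; congr (_%:R); under eq_bigr do rewrite mulnC.
  rewrite sum_count_mem; elim: s => [|x s IH]; first by rewrite big_nil.
  by rewrite big_cons IH.
rewrite -sum_count_mem natr_sum; apply: eq_bigr => u _.
by rewrite natrM expr2.
Qed.

Lemma count_adj_le_card (s : seq G) (u : G) : uniq s -> (count (adj u) s <= #|adj u|)%N.
Proof.
move=> us; rewrite -size_filter -(card_uniqP _) ?filter_uniq //.
by apply/subset_leq_card/subsetP => x; rewrite mem_filter => /andP[].
Qed.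

(* Cauchy-Schwarz: the degrees of the five vertices of [s] sum to at least [2 n],
   and the other degrees are at least 2. *)
Lemma five_hubs (s : seq G) : uniq s -> size s = 5 ->
  (forall u, (2 <= count (adj u) s)%N) -> (5 < #|G|)%N ->
  4 * #|G|%:R + 3 <= 5 * rho ^+ 2.
Proof.
move=> us ss cov n6; set n := #|G| in n6 *.
pose d (u : G) : R := #|adj u|%:R.
have dE u : d u = (count (adj u) (enum G))%:R.
  by rewrite /d -sum1_card -sum1_count big_enum_cond.
have degs : \sum_u d u ^+ 2 <= rho ^+ 2 * n%:R.
  have := sum_sqr_count_adj_le (enum G); congr (_ <= _ * _).
    by rewrite natr_sum; apply: eq_bigr => u _; rewrite dE natrX.
  congr (_%:R); rewrite (eq_bigr (fun=> 1%N)) => [|x _].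
    by rewrite sum1_size -cardE.
  by rewrite count_uniq_mem ?enum_uniq // mem_enum.
(* The least possible mean degree of the five hubs; squaring is bounded below by its tangent
   there. *)
pose t : R := 2 * n%:R / 5.
have sum_d : 2 * n%:R <= \sum_(u <- s) d u.
  have -> : \sum_(u <- s) d u = (\sum_u count (adj u) s)%:R.
    rewrite natr_sum; under [RHS]eq_bigr do rewrite -sum1_count natr_sum.
    rewrite (exchange_big_dep predT) //=; apply: eq_bigr => u _.
    rewrite /d -sum1_card natr_sum; apply: eq_bigl => w.
    by rewrite unfold_in adj_sym.
  rewrite -natrM ler_nat mulnC /n -(sum_nat_const G).
  exact: leq_sum.
have : \sum_(u in s) (2 * t * d u - t ^+ 2) + \sum_(u | u \notin s) 4
       <= \sum_u d u ^+ 2.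
  rewrite [leRHS](bigID (mem s)) /= lerD //; apply: ler_sum => u _.
    by have := sqr_ge0 (d u - t); rewrite sqrrB; lra.
  have : (2 <= #|adj u|)%N := leq_trans (cov u) (count_adj_le_card _ us).
  rewrite -(ler_nat R) -/(d u) => ?; nra.
have -> : \sum_(u | u \notin s) 4 = 4 * (n%:R - 5) :> R.
  have <- : #|[predC s]|%:R = n%:R - 5 :> R.
    by rewrite /n -(cardC (mem s)) (card_uniqP us) ss natrD; lra.
  by rewrite sumr_const mulr_natr.
rewrite -big_uniq //= sumrB -mulr_sumr big_const_seq count_predT ss iter_addr_0.
rewrite -mulr_natr => H.
have nR : 6 <= n%:R :> R by rewrite ler_nat.
have tn : 5 * t = 2 * n%:R by rewrite /t; lra.
have t0 : 0 <= t by rewrite /t; lra.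
have : 4 * t * n%:R - 5 * t ^+ 2 + 4 * (n%:R - 5) <= rho ^+ 2 * n%:R by nra.
have -> : t = 2 / 5 * n%:R by lra.
(* Divided by [n], the bound reads [5 rho^2 >= 4 n + 20 - 100 / n], which suffices from [n = 6]
   on. *)
move: nR; move: (n%:R : R) (rho ^+ 2) => m r2 m6 H1.
have m0 : 0 < m by lra.
by rewrite -(ler_pM2r m0); nra.
Qed.

End Hubs.

(** * Graphs in which no neighbourhood is a twin class *)

Section Cases.
Variables (R : realType) (G : sgraph).
Hypotheses (conG : sg_connected G) (rk5 : graph_rank R G = 5).
Implicit Types i v a b c u w : G.
Let rho : R := spectral_radius R G.

Let G0 : (0 < #|G|)%N.
Proof.
move: (rank_leq_row (adjacency R G)).
by rewrite -/(graph_rank R G) rk5 => /(leq_trans _)->.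
Qed.

Lemma pendant_triangleC12 i v a b c :
  pendant_triangle i v a b c -> pendant_triangle i v b a c.
Proof.
rewrite /pendant_triangle (adj_sym b a).
by case/and5P=> -> -> -> -> /and3P[-> -> ->].
Qed.

Lemma pendant_triangleC23 i v a b c :
  pendant_triangle i v a b c -> pendant_triangle i v a c b.
Proof.
rewrite /pendant_triangle (adj_sym c b).
by case/and5P=> -> -> -> -> /and3P[-> -> ->].
Qed.

Lemma signature_inj i v a b c u w : pendant_triangle i v a b c ->
  signature i v a b c u = signature i v a b c w -> adj u =1 adj w.
Proof.
move=> cfg uw x; have := adj_frame_form rk5 cfg u x.
rewrite uw -(eqP (adj_frame_form rk5 cfg _ _)).
by do 2 case: adj.
Qed.

(** The squared norm of the vector with weight 2 on [s1] and 1 on [s2]. *)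
Lemma sum_count_mem_double (s1 s2 : seq G) : uniq (s1 ++ s2) ->
  (\sum_(x <- s1 ++ s1 ++ s2) count_mem x (s1 ++ s1 ++ s2) =
   4 * size s1 + size s2)%N.
Proof.
rewrite cat_uniq => /and3P[u1 /hasPn d12 u2].
have E1 x : x \in s1 -> count_mem x (s1 ++ s1 ++ s2) = 2%N.
  move=> xs; rewrite !count_cat !count_uniq_mem // xs.
  by case: (boolP (x \in s2)) => // /d12; rewrite /= xs.
have E2 x : x \in s2 -> count_mem x (s1 ++ s1 ++ s2) = 1%N.
  by move=> xs; rewrite !count_cat !count_uniq_mem // xs (negPf (d12 _ xs)).
rewrite !big_cat /= (eq_big_seq _ E1) (eq_big_seq _ E2).
rewrite !big_const_seq !count_predT !iter_addn_0.
by rewrite mul1n addnA -mulnDl.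
Qed.

Lemma frame_signature i v a b c : pendant_triangle i v a b c ->
  let s := signature i v a b c in
  [/\ s i = (false, true, adj i a, adj i b, adj i c),
      s v = (true, false, false, false, false),
      s a = (adj i a, false, false, true, true),
      s b = (adj i b, false, true, false, true) &
      s c = (adj i c, false, true, true, false)].
Proof.
case/and5P=> vi /negPf va /negPf vb /negPf vc /and3P[ab ac bc].
rewrite /signature !adj_irrefl !(adj_sym _ v) !(adj_sym _ i) (adj_sym i v).
by rewrite vi va vb vc (adj_sym b a) (adj_sym c a) (adj_sym c b) ab ac bc.
Qed.

Lemma has_nbr (x y : G) : x != y -> forall u, exists w, adj u w.
Proof.
move=> xy u; have [w uw|nw] := pickP (adj u); first by exists w.
have cl : closed (@adj G) (pred1 u).
  move=> w1 w2 w12; rewrite !inE; apply/eqP/eqP => e; move: w12.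
    by rewrite e nw.
  by rewrite adj_sym e nw.
case/negP: xy; have := closed_connect cl (conG u x).
have := closed_connect cl (conG u y).
by rewrite !inE eqxx => /esym/eqP -> /esym/eqP ->.
Qed.

(** There are no loops, so every signature is isotropic for the form, and it is nonzero because each
    vertex has a neighbour. The case analyses below rest on how few signatures this leaves. *)
Lemma frame_form_self i v a b c u : pendant_triangle i v a b c ->
  (signature i v a b c u != (false, false, false, false, false)) &&
  (frame_form (adj i a) (adj i b) (adj i c)
    (signature i v a b c u) (signature i v a b c u) == 0).
Proof.
move=> cfg; rewrite -(eqP (adj_frame_form rk5 cfg _ _)) adj_irrefl andbT.
have vi : v != i by apply/eqP => e; case/andP: cfg; rewrite e adj_irrefl.
have [w uw] := has_nbr vi u; apply/negP => /eqP su.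
have := adj_frame_form rk5 cfg u w; rewrite su uw /frame_form.
by case: (signature i v a b c w) => [[[[[] []] []] []] []];
   case: (adj i a); case: (adj i b); case: (adj i c).
Qed.

(** With weight 1 on the frame, [v] sees weight 1 and [w] weight 4, while every admissible signature
    other than that of [v] sees at least 2. As [v] has no twin, the squares sum to at least
    [4 n + 9]. *)
Lemma prism_bound_unique i v a b c w : pendant_triangle i v a b c ->
  signature i v a b c i = (false, true, true, false, false) ->
  signature i v a b c w = (false, true, true, true, true) ->
  (forall u, adj u =1 adj v -> u = v) ->
  4 * #|G|%:R + 3 <= 5 * rho ^+ 2.
Proof.
move=> cfg si sw uniqv; have [si' sv sa sb sc] := frame_signature cfg.
have [ia ib ic] : [/\ adj i a, adj i b = false & adj i c = false].
  by case: si => _ _ -> -> ->.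
rewrite ia ib ic in sa sb sc; pose s := [:: i; v; a; b; c].
have us : uniq s.
  rewrite /= !inE !negb_or !andbT.
  by repeat (apply/andP; split); apply/eqP => e; congruence.
have wv : w != v by apply/eqP => e; congruence.
have := sum_sqr_count_adj_le R conG G0 s; rewrite -/rho.
have -> : (\sum_(x <- s) count_mem x s = 5)%N.
  rewrite big_seq (eq_bigr (fun=> 1%N)) => [|x xs]; last by rewrite count_uniq_mem // xs.
  by rewrite -big_seq big_const_seq.
move=> H; rewrite [5 * _]mulrC; apply: le_trans H.
pose F u := (count (adj u) s ^ 2)%N.
have cE u : F u = (let: (xi, xv, xa, xb, xc) := signature i v a b c u in
   (xi + (xv + (xa + (xb + (xc + 0)))))%N ^ 2)%N by [].
rewrite -natrM -natrD ler_nat -[(\sum_u _)%N]/(\sum_u F u)%N.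
have Fv : F v = 1%N by rewrite cE sv.
have Fw : F w = 16%N by rewrite cE sw.
rewrite (bigD1 v) //= (bigD1 w) //= Fv Fw.
have : (\sum_(u | (u != v) && (u != w)) 4 <=
        \sum_(u | (u != v) && (u != w)) F u)%N.
  apply: leq_sum => u /andP[uv _]; rewrite cE -[4%N]/(2 ^ 2)%N leq_exp2r //.
  have := frame_form_self u cfg; rewrite ia ib ic.
  have: signature i v a b c u != signature i v a b c v.
    by apply: contra_neq uv => /(signature_inj cfg)/uniqv.
  rewrite sv /signature; case: (adj u i); case: (adj u v);
  by case: (adj u a); case: (adj u b); case: (adj u c).
have cG : (#|[pred u | (u != v) && (u != w)]| = #|G| - 2)%N.
  have := cardC (mem [:: v; w]).
  rewrite (card_uniqP _) /= ?inE 1?eq_sym ?wv // => <-.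
  rewrite addnC addnK; apply: eq_card => u.
  by rewrite !inE !negb_or andbT.
rewrite sum_nat_const cG.
move=> HS.
suff arith (n S : nat) : ((n - 2) * 4 <= S -> 4 * n + 3 <= 1 + (16 + S))%N.
  exact: arith HS.
by clear; lia.
Qed.

Lemma unique_row_or_twin (x : G) : (forall u, adj u =1 adj x -> u = x) \/
  exists2 u : G, u != x & adj u =1 adj x.
Proof.
have [u /andP[ux /forallP ex]|no] :=
  pickP [pred u | (u != x) && [forall y, adj u y == adj x y]].
  by right; exists u => // y; apply/eqP.
left=> u ux; apply/eqP/negPn/negP => unx; move: (no u); rewrite /= unx /=.
by move/negP => []; apply/forallP => y; rewrite ux.
Qed.

(** If [v] or [i] has no twin, [prism_bound_unique] applies, by symmetry in the second case; twins
    of both allow another weighting. *)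
Lemma prism_bound i v a b c w : pendant_triangle i v a b c ->
  signature i v a b c i = (false, true, true, false, false) ->
  signature i v a b c w = (false, true, true, true, true) ->
  4 * #|G|%:R + 3 <= 5 * rho ^+ 2.
Proof.
move=> cfg si sw; have [si' sv sa sb sc] := frame_signature cfg.
have [ia ib ic] : [/\ adj i a, adj i b = false & adj i c = false].
  by case: si => _ _ -> -> ->.
rewrite ia ib ic in sa sb sc.
have [wi wv wa wb wc] :
    [/\ adj w i = false, adj w v, adj w a, adj w b & adj w c].
  by case: sw => -> -> -> -> ->.
have [vi va vb vc] : [/\ adj v i, adj v a = false, adj v b = false & adj v c = false].
  by case: sv => -> _ -> -> ->.
have bc : adj b c by case: sb => _ _ _ _ ->.
have ab : adj a b by case: sa => _ _ _ -> _.
have ac : adj a c by case: sa => _ _ _ _ ->.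
have av : adj a v = false by rewrite adj_sym.
have [uv|[v' v'v rv']] := unique_row_or_twin v.
  exact: prism_bound_unique cfg si sw uv.
have [ui|[i' i'i ri']] := unique_row_or_twin i.
  (* The configuration is symmetric under exchanging [i, a] with [v, w]. *)
  apply: (@prism_bound_unique v i w b c a) => //.
  - by rewrite /pendant_triangle (adj_sym i v) vi (adj_sym i w) wi ib ic wb wc bc.
  - by rewrite /signature vi (adj_sym v w) wv adj_irrefl vb vc.
  - by rewrite /signature av (adj_sym a i) ia (adj_sym a w) wa ab ac.
have sv' : signature i v a b c v' = signature i v a b c v by rewrite /signature !rv'.
have si1 : signature i v a b c i' = signature i v a b c i by rewrite /signature !ri'.
rewrite sv in sv'; rewrite si in si1.
(* Weight 2 on [s1] and 1 on [s2] has squared norm 20; [w] sees weight 8 and every other vertex at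
   least 4, so [20 rho^2 >= 16 n + 48]. *)
pose s1 := [:: a; w; b; c]; pose s2 := [:: i; i'; v; v'].
have us : uniq (s1 ++ s2).
  rewrite /= !inE !negb_or !andbT (eq_sym i) i'i (eq_sym v) v'v !andbT /=.
  by repeat (apply/andP; split); apply/eqP => e; congruence.
have := sum_sqr_count_adj_le R conG G0 (s1 ++ s1 ++ s2).
rewrite (sum_count_mem_double us) /= -/rho => H.
suff : (16 * #|G| + 12 <= \sum_u count (adj u) (s1 ++ s1 ++ s2) ^ 2)%N.
  rewrite -(ler_nat R) => /le_trans/(_ H).
  by rewrite natrD natrM; lra.
have cE u : count (adj u) (s1 ++ s1 ++ s2) =
    let: (xi, xv, xa, xb, xc) := signature i v a b c u in
    (2 * (xa + adj u w + xb + xc + xi + xv))%N.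
  rewrite !count_cat /= (adj_sym u i') (adj_sym u v') ri' rv' !(adj_sym _ u).
  by case: (adj u w); case: (adj u i); case: (adj u v); case: (adj u a);
     case: (adj u b); case: (adj u c).
pose F u := (count (adj u) (s1 ++ s1 ++ s2) ^ 2)%N.
have Fw : F w = 64%N by rewrite /F cE sw adj_irrefl.
rewrite -[(\sum_u _)%N]/(\sum_u F u)%N (bigD1 w) //= Fw.
have : (\sum_(u | u != w) 16 <=
        \sum_(u | u != w) F u)%N.
  apply: leq_sum => u _; rewrite /F -[16%N]/(4 ^ 2)%N leq_exp2r // cE.
  have := frame_form_self u cfg; have := adj_frame_form rk5 cfg u w.
  rewrite ia ib ic sw /signature.
  case: (adj u w); case: (adj u i); case: (adj u v);
  by case: (adj u a); case: (adj u b); case: (adj u c).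
rewrite sum_nat_const; have := cardC1 w.
rewrite (eq_card (B := predC1 w)) // => -> /= HS.
suff arith (n S : nat) : (n.-1 * 16 <= S -> 16 * n + 12 <= 64 + S)%N.
  exact: arith HS.
by clear; lia.
Qed.

Lemma six_le_card (s : seq G) : uniq s -> size s = 6 -> (5 < #|G|)%N.
Proof. by move=> us ss; rewrite -[6%N]ss -(card_uniqP us) max_card. Qed.

(** Replacing [v] by [w] in the frame gives five hubs: every admissible signature has two neighbours
    among them. *)
Lemma triangle_hubs_bound1 i v a b c w : pendant_triangle i v a b c ->
  signature i v a b c i = (false, true, true, false, false) ->
  signature i v a b c w = (true, true, false, true, false) ->
  4 * #|G|%:R + 3 <= 5 * rho ^+ 2.
Proof.
move=> cfg si sw; have [si' sv sa sb sc] := frame_signature cfg.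
have [ia ib ic] : [/\ adj i a, adj i b = false & adj i c = false].
  by case: si => _ _ -> -> ->.
rewrite ia ib ic in sa sb sc.
have us : uniq [:: v; i; w; a; b; c].
  rewrite /= !inE !negb_or !andbT.
  by repeat (apply/andP; split); apply/eqP => e; congruence.
apply: (@five_hubs _ _ conG G0 [:: i; w; a; b; c]) => //.
- by case/andP: us.
- move=> u; have := frame_form_self u cfg; have := adj_frame_form rk5 cfg u w.
  rewrite ia ib ic sw /= /signature.
  case: (adj u w); case: (adj u i); case: (adj u v); case: (adj u a);
  by case: (adj u b); case: (adj u c).
- exact: six_le_card us _.
Qed.

(** The hubs are again [i], [w], [a], [b], [c]. A vertex with [v] as its only frame neighbour would
    see none of them, so that signature is excluded. *)
Lemma triangle_hubs_bound2 i v a b c w : pendant_triangle i v a b c ->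
  signature i v a b c i = (false, true, true, true, false) ->
  signature i v a b c w = (true, true, false, true, true) ->
  (forall u, signature i v a b c u <> (false, true, false, false, false)) ->
  4 * #|G|%:R + 3 <= 5 * rho ^+ 2.
Proof.
move=> cfg si sw nou; have [si' sv sa sb sc] := frame_signature cfg.
have [ia ib ic] : [/\ adj i a, adj i b & adj i c = false].
  by case: si => _ _ -> -> ->.
rewrite ia ib ic in sa sb sc.
have us : uniq [:: v; i; w; a; b; c].
  rewrite /= !inE !negb_or !andbT.
  by repeat (apply/andP; split); apply/eqP => e; congruence.
apply: (@five_hubs _ _ conG G0 [:: i; w; a; b; c]) => //.
- by case/andP: us.
- move=> u; have := frame_form_self u cfg; have := adj_frame_form rk5 cfg u w.
  have := nou u; rewrite ia ib ic sw /= /signature.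
  case: (adj u w); case: (adj u i); case: (adj u v); case: (adj u a);
  by case: (adj u b); case: (adj u c).
- exact: six_le_card us _.
Qed.

(* [v] behaves like a pendant vertex. *)
Definition leaf_frame i v a b c :=
  pendant_triangle i v a b c /\ forall w, adj w v -> adj w =1 adj i.

Definition bounded_or_leaf :=
  4 * #|G|%:R + 3 <= 5 * rho ^+ 2 \/ exists i v a b c, leaf_frame i v a b c.

(** If all neighbours of [i] are twins of [v], exchanging [i] and [v] gives a leaf frame; any other
    neighbour [y] of [i] leads to [prism_bound]. *)
Lemma cycle_bounded_or_leaf i v a b c w : pendant_triangle i v a b c ->
  signature i v a b c i = (false, true, false, false, false) ->
  signature i v a b c w = (false, true, true, true, false) ->
  bounded_or_leaf.
Proof.
move=> cfg si sw; have [si' sv sa sb sc] := frame_signature cfg.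
have [ia ib ic] : [/\ adj i a = false, adj i b = false & adj i c = false].
  by case: si => _ _ -> -> ->.
rewrite ia ib ic in sa sb sc.
have vi : adj v i by case: sv => ->.
have [ab ac bc] : [/\ adj a b, adj a c & adj b c].
  by case: sa sb => _ _ _ -> -> [_ _ _ _ ->].
have [wi wv wa wb] : [/\ adj w i = false, adj w v, adj w a & adj w b].
  by case: sw => -> -> -> ->.
have [y /andP[yi ynv]|leaf] :=
  pickP [pred y | adj y i && ~~ [forall x, adj y x == adj v x]].
- left.
  (* Isotropy and the form against [w] leave one signature for [y], so [y], [a], [b] is a triangle
     avoiding [v]. *)
  have sy : signature i v a b c y = (true, false, true, true, false) /\ adj y w.
    have nsv : signature i v a b c y != signature i v a b c v.
      by apply: contra ynv => /eqP/(signature_inj cfg) e; apply/forallP => x; rewrite e.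
    move: nsv; have := frame_form_self y cfg; have := adj_frame_form rk5 cfg y w.
    rewrite sv ia ib ic sw /= /signature yi.
    case: (adj y w); case: (adj y v); case: (adj y a);
    by case: (adj y b); case: (adj y c).
  case: sy => sy yw.
  have [_ yv ya yb yc] :
      [/\ adj y i, adj y v = false, adj y a, adj y b & adj y c = false].
    by case: sy => -> -> -> -> ->.
  apply: (@prism_bound i v y a b w).
  + rewrite /pendant_triangle vi (adj_sym v y) yv ya yb ab.
    by case: sv => _ _ -> -> _.
  + by rewrite /signature adj_irrefl (adj_sym i v) vi (adj_sym i y) yi ia ib.
  + by rewrite /signature wi wv (adj_sym w y) yw wa wb.
- right; exists v, i, a, b, c; split.
    rewrite /pendant_triangle (adj_sym i v) vi ia ib ic ab ac bc //.
  move=> y yi x; move: (leaf y); rewrite /= yi /= => /negbFE/forallP/(_ x)/eqP //.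
Qed.

Lemma frame_signature_i i v a b c : pendant_triangle i v a b c ->
  signature i v a b c i = (false, true, adj i a, adj i b, adj i c).
Proof. by case/frame_signature. Qed.

(** The digit in the name counts the neighbours of [i] in the triangle. Isotropy makes [w] adjacent
    to exactly two triangle vertices and not to [i]; the three cases differ by a permutation. *)
Lemma frame0_bounded_or_leaf i v a b c w : pendant_triangle i v a b c ->
  adj i a = false -> adj i b = false -> adj i c = false ->
  adj w v -> ~ adj w =1 adj i -> bounded_or_leaf.
Proof.
move=> cfg ia ib ic wv wi; have si := frame_signature_i cfg.
rewrite ia ib ic in si.
have nsi : signature i v a b c w != signature i v a b c i.
  by apply/eqP => /(signature_inj cfg)/wi.
have := frame_form_self w cfg; move: nsi; rewrite si ia ib ic /signature wv.
case Ei: (adj w i); case Ea: (adj w a); case Eb: (adj w b); case Ec: (adj w c) => //= _ _.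
- by apply: (cycle_bounded_or_leaf cfg si (w := w)); rewrite /signature Ei wv Ea Eb Ec.
- apply: (cycle_bounded_or_leaf (pendant_triangleC23 cfg) (w := w)).
    by case: si => *; rewrite /signature; congr (_, _, _, _, _).
  by rewrite /signature Ei wv Ea Eb Ec.
- apply: (cycle_bounded_or_leaf (pendant_triangleC23 (pendant_triangleC12 cfg)) (w := w)).
    by case: si => *; rewrite /signature; congr (_, _, _, _, _).
  by rewrite /signature Ei wv Ea Eb Ec.
Qed.

(** Isotropy leaves three signatures for [w]: two lead to [triangle_hubs_bound1], up to exchanging
    [b] and [c], and one to [prism_bound]. *)
Lemma frame1_bound i v a b c w : pendant_triangle i v a b c ->
  adj i a -> adj i b = false -> adj i c = false ->
  adj w v -> ~ adj w =1 adj i -> 4 * #|G|%:R + 3 <= 5 * rho ^+ 2.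
Proof.
move=> cfg ia ib ic wv wi; have si := frame_signature_i cfg.
rewrite ia ib ic in si.
have nsi : signature i v a b c w != signature i v a b c i.
  by apply/eqP => /(signature_inj cfg)/wi.
have := frame_form_self w cfg; move: nsi; rewrite si ia ib ic /signature wv.
case Ei: (adj w i); case Ea: (adj w a); case Eb: (adj w b); case Ec: (adj w c) => //= _ _.
- by apply: (triangle_hubs_bound1 cfg si (w := w)); rewrite /signature Ei wv Ea Eb Ec.
- apply: (triangle_hubs_bound1 (pendant_triangleC23 cfg) (w := w)).
    by case: si => *; rewrite /signature; congr (_, _, _, _, _).
  by rewrite /signature Ei wv Ea Eb Ec.
- by apply: (prism_bound cfg si (w := w)); rewrite /signature Ei wv Ea Eb Ec.
Qed.

(** A vertex [u] seeing only [v] in the frame can replace [i], which leads back to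
    [frame0_bounded_or_leaf]; without such a vertex [triangle_hubs_bound2] applies. *)
Lemma frame2_bounded_or_leaf i v a b c w : pendant_triangle i v a b c ->
  adj i a -> adj i b -> adj i c = false ->
  adj w v -> ~ adj w =1 adj i -> bounded_or_leaf.
Proof.
move=> cfg ia ib ic wv wi; have si := frame_signature_i cfg.
rewrite ia ib ic in si.
have [u su|nou] := pickP [pred u | signature i v a b c u ==
                                    (false, true, false, false, false)].
  case/eqP: su => ui uv ua ub uc.
  have iu : adj i u = false by rewrite adj_sym.
  apply: (@frame0_bounded_or_leaf u v a b c i) => //.
  - case/and5P: cfg => _ va vb vc tr.
    by rewrite /pendant_triangle (adj_sym v u) uv va vb vc.
  - by case/andP: cfg; rewrite adj_sym.
  - by move=> /(_ a); rewrite ia ua.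
left; have nou' u : signature i v a b c u <> (false, true, false, false, false).
  by move/eqP=> su; move: (nou u); rewrite /= su.
have nsi : signature i v a b c w != signature i v a b c i.
  by apply/eqP => /(signature_inj cfg)/wi.
have := frame_form_self w cfg; have := nou' w; move: nsi.
rewrite si ia ib ic /signature wv.
case Ei: (adj w i); case Ea: (adj w a); case Eb: (adj w b); case Ec: (adj w c) => //= _ _ _.
- apply: (triangle_hubs_bound2 (pendant_triangleC12 cfg) (w := w)).
  + by case: si => *; rewrite /signature; congr (_, _, _, _, _).
  + by rewrite /signature Ei wv Ea Eb Ec.
  + by move=> u [? ? ? ? ?]; apply: (nou' u); rewrite /signature; congr (_, _, _, _, _).
- by apply: (triangle_hubs_bound2 cfg si (w := w)) => //; rewrite /signature Ei wv Ea Eb Ec.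
Qed.

(** Up to a permutation, [w] sees only [v] and [a] in the frame. With [w] in place of [i],
    [frame1_bound] applies, and [i] is the vertex that is not a twin. *)
Lemma frame3_bound i v a b c w : pendant_triangle i v a b c ->
  adj i a -> adj i b -> adj i c ->
  adj w v -> ~ adj w =1 adj i -> 4 * #|G|%:R + 3 <= 5 * rho ^+ 2.
Proof.
move=> cfg ia ib ic wv wi; have si := frame_signature_i cfg.
rewrite ia ib ic in si.
have iv : adj i v by case/andP: cfg; rewrite adj_sym.
wlog [wia wia' wib wic] : a b c cfg ia ib ic si /
    [/\ adj w i = false, adj w a, adj w b = false & adj w c = false].
  move=> IH; have nsi : signature i v a b c w != signature i v a b c i.
    by apply/eqP => /(signature_inj cfg)/wi.
  have := frame_form_self w cfg; move: nsi; rewrite si ia ib ic /signature wv.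
  case Ei: (adj w i); case Ea: (adj w a); case Eb: (adj w b); case Ec: (adj w c) => //= _ _.
  - by apply: (IH a b c) => //; split.
  - have cfg' := pendant_triangleC12 cfg.
    apply: (IH b a c cfg' ib ia ic); last by split.
    by rewrite (frame_signature_i cfg') ia ib ic.
  - have cfg' := pendant_triangleC12 (pendant_triangleC23 cfg).
    apply: (IH c a b cfg' ic ia ib); last by split.
    by rewrite (frame_signature_i cfg') ia ib ic.
have cfg' : pendant_triangle w v a b c.
  case/and5P: cfg => _ va vb vc tr.
  by rewrite /pendant_triangle (adj_sym v w) wv va vb vc.
apply: (frame1_bound cfg' (w := i)) => //.
by move=> /(_ b); rewrite ib wib.
Qed.

Lemma pendant_triangle_bounded_or_leaf i v a b c :
  pendant_triangle i v a b c -> bounded_or_leaf.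
Proof.
move=> cfg.
have [w /andP[wv wni]|leaf] :=
    pickP [pred w | adj w v && ~~ [forall x, adj w x == adj i x]]; last first.
  right; exists i, v, a, b, c; split=> // w wv x.
  by move: (leaf w); rewrite /= wv /= => /negbFE/forallP/(_ x)/eqP.
have wi : ~ adj w =1 adj i.
  by move=> e; case/negP: wni; apply/forallP => x; rewrite e.
have cfg1 := pendant_triangleC12 cfg; have cfg2 := pendant_triangleC23 cfg.
have cfg3 := pendant_triangleC23 cfg1; have cfg4 := pendant_triangleC12 cfg2.
case Ea: (adj i a); case Eb: (adj i b); case Ec: (adj i c).
- by left; exact: (frame3_bound cfg Ea Eb Ec wv wi).
- exact: (frame2_bounded_or_leaf cfg Ea Eb Ec wv wi).
- exact: (frame2_bounded_or_leaf cfg2 Ea Ec Eb wv wi).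
- by left; exact: (frame1_bound cfg Ea Eb Ec wv wi).
- exact: (frame2_bounded_or_leaf cfg3 Eb Ec Ea wv wi).
- by left; exact: (frame1_bound cfg1 Eb Ea Ec wv wi).
- by left; exact: (frame1_bound cfg4 Ec Ea Eb wv wi).
- exact: (frame0_bounded_or_leaf cfg Ea Eb Ec wv wi).
Qed.
End Cases.

(** * Five hubs or a frame *)

Section Exchange.
Variables (R : realType) (G : sgraph).
Hypotheses (conG : sg_connected G) (rk5 : graph_rank R G = 5).

(** Of the graphs on three vertices, only the triangle has a nonsingular adjacency matrix. *)
Lemma triangle_free_kernel (pq pr qr : bool) : ~~ [&& pq, pr & qr] ->
  exists x y z : R, [/\ y * pq%:R + z * pr%:R = 0, x * pq%:R + z * qr%:R = 0,
     x * pr%:R + y * qr%:R = 0 & ~ [/\ x = 0, y = 0 & z = 0]].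
Proof.
have one0 : (1 : R) <> 0 by apply/eqP; exact: oner_neq0.
case: pq; case: pr; case: qr => //= _.
- by exists 0, 1, (-1); split; [ring..|case].
- by exists 1, 0, (-1); split; [ring..|case].
- by exists 0, 0, 1; split; [ring..|case].
- by exists 1, (-1), 0; split; [ring..|case].
- by exists 0, 1, 0; split; [ring..|case].
- by exists 1, 0, 0; split; [ring..|case].
- by exists 1, 0, 0; split; [ring..|case].
Qed.

Lemma ord5_others (i k : 'I_5) : i != k ->
  exists a b c : 'I_5, perm_eq (index_enum 'I_5) [:: i; k; a; b; c].
Proof.
move=> ik; pose s := [seq x <- enum 'I_5 | x \notin [:: i; k]].
have uik : uniq [:: i; k] by rewrite /= inE ik.
have us : uniq s by rewrite filter_uniq ?enum_uniq.
have ps : perm_eq (index_enum 'I_5) ([:: i; k] ++ s).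
  apply: uniq_perm; first exact: index_enum_uniq.
    rewrite cat_uniq uik us andbT; apply/hasPn => x.
    by rewrite mem_filter => /andP[].
  move=> x; rewrite mem_index_enum mem_cat mem_filter mem_enum andbT.
  by case: (x \in _).
have := perm_size ps; rewrite size_cat -sum1_size sum1_card card_ord.
by case: s ps {us} => [|a [|b [|c [|]]]] //= ps _; exists a, b, c.
Qed.

(* Some [h k] with [k <> i] occurs in the expansion of the row of [v], so [v] can
   replace it; the remaining three vertices then carry a nonsingular submatrix,
   and the only such graph is a triangle. *)
Lemma exchange_pendant (h : 'I_5 -> G) (v : G) (i : 'I_5) :
  nonsingular_on R h -> (forall j, adj v (h j) = (j == i)) ->
  exists a b c, pendant_triangle (h i) v a b c.
Proof.
move=> nd vh; have [z zE] := nonsingular_spans rk5 nd v.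
have zh x : \sum_j z j * (adj (h j) (h x))%:R = (x == i)%:R by rewrite -zE vh.
(* Evaluated at [v] itself, the expansion of the row of [v] reduces to [z i]. *)
have zi : z i = 0.
  have /esym := zE v; rewrite adj_irrefl (bigD1 i) //= adj_sym vh eqxx mulr1.
  rewrite big1 ?addr0 // => j ji; rewrite adj_sym vh (negPf ji) mulr0 //.
have [k zk] : exists k, z k != 0.
  have [k zk|z0] := pickP [pred k | z k != 0]; first by exists k.
  have /eqP := zh i; rewrite eqxx big1 ?(eq_sym 0) ?oner_eq0 // => j _.
  by have /negbFE/eqP -> := z0 j; rewrite mul0r.
have ik : i != k by apply: contra_neq zk => <-.
have [a [b [c pe]]] := ord5_others ik.
have sumE (F : 'I_5 -> R) : \sum_j F j = F i + F k + F a + F b + F c.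
  by rewrite (perm_big _ pe) /= !big_cons big_nil addr0 !addrA.
have : uniq [:: i; k; a; b; c] by rewrite -(perm_uniq pe) index_enum_uniq.
rewrite /= !inE !negb_or !andbT -!andbA => /and5P[_ ia ib ic /and5P[ka kb kc ab /andP[ac bc]]].
exists (h a), (h b), (h c).
rewrite /pendant_triangle !vh eqxx !(eq_sym _ i) ia ib ic /=.
apply/negPn/negP => /triangle_free_kernel[xa [xb [xc [Ea Eb Ec nz]]]].
(* A kernel vector of the submatrix on [a], [b], [c], extended by 0; [f] is its image under the
   submatrix on [h]. *)
pose x (j : 'I_5) := if j == a then xa else if j == b then xb else if j == c then xc else 0.
have [xi xk xa' xb' xc'] : [/\ x i = 0, x k = 0, x a = xa, x b = xb & x c = xc].
  rewrite /x !eqxx (negPf ia) (negPf ib) (negPf ic) (negPf ka) (negPf kb) (negPf kc).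
  by rewrite eq_sym (negPf ab) eq_sym (negPf ac) eq_sym (negPf bc).
pose f y : R := \sum_j x j * (adj (h j) (h y))%:R.
have fa : f a = 0.
  rewrite /f sumE xi xk xa' xb' xc' adj_irrefl (adj_sym (h b)) (adj_sym (h c)).
  by apply: etrans Ea; rewrite /=; ring.
have fb : f b = 0.
  rewrite /f sumE xi xk xa' xb' xc' adj_irrefl (adj_sym (h c)).
  by apply: etrans Eb; rewrite /=; ring.
have fc : f c = 0.
  rewrite /f sumE xi xk xa' xb' xc' adj_irrefl.
  by apply: etrans Ec; rewrite /=; ring.
(* The image of [z] is the unit vector at [i], so pairing [z] with [f] gives [x i = 0], and only the
   term at [k] survives. *)
have fk : f k = 0.
  have : \sum_m z m * f m = x i.
    under eq_bigr do rewrite mulr_sumr.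
    rewrite exchange_big (bigD1 i) //= [X in _ + X]big1 => [|j /negPf ji].
      under eq_bigr do rewrite mulrCA adj_sym.
      by rewrite -mulr_sumr zh eqxx mulr1 addr0.
    under eq_bigr do rewrite mulrCA adj_sym.
    by rewrite -mulr_sumr zh ji mulr0.
  rewrite sumE zi xi fa fb fc !mulr0 !addr0 mul0r add0r => /eqP.
  by rewrite mulf_eq0 (negPf zk) => /eqP.
(* Now [f] is supported at [i], so nonsingularity gives [x = f i * z]; at [k] this forces
   [f i = 0]. *)
have xz j : x j = f i * z j.
  apply/eqP; rewrite -subr_eq0; apply/eqP; apply: (nd (fun j => x j - f i * z j)) => y.
  under eq_bigr do rewrite mulrBl -mulrA.
  rewrite sumrB -mulr_sumr zh -/(f y).
  have : y \in index_enum 'I_5 by rewrite mem_index_enum.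
  rewrite (perm_mem pe) !inE => /or4P[/eqP->|/eqP->|/eqP->|/orP[/eqP->|/eqP->]].
  - by rewrite eqxx mulr1 subrr.
  - by rewrite fk eq_sym (negPf ik) mulr0 subr0.
  - by rewrite fa eq_sym (negPf ia) mulr0 subr0.
  - by rewrite fb eq_sym (negPf ib) mulr0 subr0.
  - by rewrite fc eq_sym (negPf ic) mulr0 subr0.
have fi : f i = 0.
  by have /esym/eqP := xz k; rewrite xk mulf_eq0 (negPf zk) orbF => /eqP.
by apply: nz; rewrite -xa' -xb' -xc' !xz fi !mul0r.
Qed.

(** A vertex with no neighbour among the five would have a zero row, against connectedness; one with
    a single neighbour is the [v] of [exchange_pendant]. *)
Lemma five_hubs_or_frame : (1 < #|G|)%N ->
  (exists s : seq G, [/\ uniq s, size s = 5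
     & forall u, (2 <= count (adj u) s)%N]) \/
  exists i v a b c : G, pendant_triangle i v a b c.
Proof.
move=> G1; have [h nd] := nonsingular_exists rk5.
have hinj := nonsingular_inj nd.
pose s := [seq h j | j <- enum 'I_5].
have cE u : count (adj u) s = (\sum_(j < 5) adj u (h j))%N.
  rewrite -sum1_count big_mkcond big_map big_enum /=.
  by apply: eq_big => j /=; case: (adj u _).
have [v|cov] := pickP [pred u | count (adj u) s < 2]%N; last first.
  left; exists s; split; first by rewrite map_inj_uniq ?enum_uniq.
    by rewrite size_map size_enum_ord.
  by move=> u; rewrite leqNgt; apply/negbT; exact: cov.
rewrite /= => vs; right.
have [i vi|v0] := pickP (fun j => adj v (h j)); last first.
  have [x [y xy]] : exists x y : G, x != y.
    by case/card_gt1P: G1 => x [y [_ _ xy]]; exists x, y.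
  have [w vw] := has_nbr conG xy v.
  have [z zE] := nonsingular_spans rk5 nd v.
  have z0 : forall j, z j = 0.
    by apply: nd => j; rewrite -zE v0.
  have /eqP := zE w; rewrite vw big1 ?oner_eq0 // => j _.
  by rewrite z0 mul0r.
have vh j : adj v (h j) = (j == i).
  case: eqP => [->//|/eqP ji]; apply/negP => vj.
  by move: vs; rewrite cE (bigD1 i) //= (bigD1 j) //= vi vj.
have [a [b [c cfg]]] := exchange_pendant nd vh.
by exists (h i), v, a, b, c.
Qed.
End Exchange.

(** * Inequalities for the classes of a leaf frame *)

Lemma gap_of_sqr_sub (R : realType) (t : R) :
  0 < t -> 4 < t ^+ 2 - t -> 27 / 2 < 3 * t ^+ 2 - t.
Proof.
move=> t0 tt; have t5 : 5 / 2 < t.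
  rewrite ltNge; apply/negP => t5.
  have : 0 <= (5 / 2 - t) * (t + 3 / 2) by rewrite mulr_ge0; lra.
  by lra.
have : 0 < (t - 5 / 2) * (t + 5 / 2) by rewrite mulr_gt0; lra.
by lra.
Qed.

(* The eigenvalue relations, summed over the classes of a graph in which a class
   [L] of [l] leaves hangs at a class [C] of [s] twins, which is joined to a
   vertex of the first part of a complete tripartite graph with parts of sizes
   [p], [q], [r]; [S0], ..., [S4] are the sums of a Perron vector over [L], [C]
   and the three parts, and [y] is its value at the vertex joined to [C]. *)
Record leaf_system (R : realType) (t l s p q r S0 S1 y S2 S3 S4 : R) : Prop :=
  LeafSystem {
    _ : 0 < t; _ : 1 <= s; _ : 1 <= l; _ : 1 <= p; _ : 1 <= q; _ : 1 <= r;
    _ : 0 < S1; _ : 0 < S2; _ : 0 < S3; _ : 0 < S4;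
    _ : t * S0 = l * S1;
    _ : s * (S0 + y) <= t * S1;
    _ : t * y = S3 + S4 + S1;
    _ : p * (S3 + S4) + S1 <= t * S2;
    _ : q * (S2 + S4) <= t * S3;
    _ : r * (S2 + S3) <= t * S4
  }.

Section LeafSystem.
Variables (R : realType) (t l s p q r S0 S1 y S2 S3 S4 : R).
Hypothesis sys : leaf_system t l s p q r S0 S1 y S2 S3 S4.

(** Multiplying the relation for [S1] by [t] eliminates [S0] and [y]. *)
Let leaf_center : s * (S3 + S4) <= (t ^+ 2 - l * s - s) * S1.
Proof.
case: sys => t0 s1 l1 p1 q1 r1 S1_gt0 S2_gt0 S3_gt0 S4_gt0 E0 E1 Ey E2 E3 E4.
have : t * (s * (S0 + y)) <= t * (t * S1) by rewrite ler_pM2l.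
rewrite (_ : t * (s * (S0 + y)) = s * (t * S0 + t * y)); last by ring.
by rewrite E0 Ey; lra.
Qed.

(** Bounding [S3] and [S4] below by multiples of [S2] eliminates [S2]. *)
Let leaf_parts :
  (t * (q + r) + 2 * (q * r)) * (p * (S3 + S4) + S1) <= t * (t ^+ 2 - q * r) * (S3 + S4).
Proof.
case: sys => t0 s1 l1 p1 q1 r1 S1_gt0 S2_gt0 S3_gt0 S4_gt0 E0 E1 Ey E2 E3 E4.
have F3 : (q * t + q * r) * S2 <= (t ^+ 2 - q * r) * S3.
  have := ler_wpM2l (ltW t0) E3; have := ler_wpM2l (le_trans ler01 q1) E4; lra.
have F4 : (r * t + q * r) * S2 <= (t ^+ 2 - q * r) * S4.
  have := ler_wpM2l (ltW t0) E4; have := ler_wpM2l (le_trans ler01 r1) E3; lra.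
have c0 : 0 <= t * (q + r) + 2 * (q * r).
  have q0 := le_trans ler01 q1.
  have r0 := le_trans ler01 r1.
  by have := mulr_ge0 (ltW t0) (addr_ge0 q0 r0); have := mulr_ge0 q0 r0; lra.
apply: le_trans (ler_wpM2l c0 E2) _.
have : t * ((q * t + q * r) * S2 + (r * t + q * r) * S2) <=
       t * ((t ^+ 2 - q * r) * S3 + (t ^+ 2 - q * r) * S4).
  by rewrite ler_pM2l // lerD.
lra.
Qed.

(** The two eliminations read [S3 + S4 <= X S1] and [S1 <= Z (S3 + S4)], whence [X Z >= 1], strictly
    if the relation for [S1] is strict. *)
Lemma leaf_system_pendant : s = 1 -> q = 1 -> r = 1 ->
  [/\ 0 < t ^+ 2 - l - 1,
      1 <= (t ^+ 2 - l - 1) * ((t ^+ 2 - t) / 2 - p)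
    & S0 + y < t * S1 -> 1 < (t ^+ 2 - l - 1) * ((t ^+ 2 - t) / 2 - p)].
Proof.
case: sys => t0 s1 l1 p1 q1 r1 S1_gt0 S2_gt0 S3_gt0 S4_gt0 E0 E1 Ey E2 E3 E4.
move=> es eq er; have S_gt0 : 0 < S3 + S4 by lra.
move: leaf_center leaf_parts; rewrite es eq er !mulr1 !mul1r => C P.
have {}P : S1 <= ((t ^+ 2 - t) / 2 - p) * (S3 + S4).
  have t1 : 0 < 2 * (1 + t) by lra.
  rewrite -(ler_pM2l t1); move: P; lra.
set X := t ^+ 2 - l - 1 in C *; set Z := (t ^+ 2 - t) / 2 - p in P *.
have X0 : 0 < X by rewrite -(pmulr_lgt0 _ S1_gt0) (lt_le_trans S_gt0).
have XZ : X * S1 <= X * Z * (S3 + S4) by rewrite -mulrA ler_pM2l.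
split=> //.
  by rewrite -(ler_pM2r S_gt0) mul1r (le_trans C).
move=> lt1; rewrite -(ltr_pM2r S_gt0) mul1r; apply: lt_le_trans XZ.
have : t * (S0 + y) < t * (t * S1) by rewrite ltr_pM2l.
by rewrite mulrDr E0 Ey /X; lra.
Qed.

(** The sizes are real numbers here, so their integrality enters as hypotheses. The second bound is
    the stronger one at order 6. *)
Lemma leaf_system_gap : 1 + 1 <= s \/ 1 + 1 + 1 <= q + r ->
  s = 1 \/ 1 + 1 <= s ->
  2 * (l + s + p + q + r) + 1 / 2 < 3 * t ^+ 2 - t /\ 27 / 2 < 3 * t ^+ 2 - t.
Proof.
case: sys => t0 s1 l1 p1 q1 r1 S1_gt0 S2_gt0 S3_gt0 S4_gt0 E0 E1 Ey E2 E3 E4.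
move=> other s12; have S_gt0 : 0 < S3 + S4 by lra.
have [h h0 S1E] : exists2 h, 0 < h & S1 = h * (S3 + S4).
  by exists (S1 / (S3 + S4)); rewrite ?divr_gt0 // divfK // gt_eqF.
have C : s <= (t ^+ 2 - l * s - s) * h.
  by rewrite -(ler_pM2r S_gt0) -mulrA -S1E leaf_center.
have P : (t * (q + r) + 2 * (q * r)) * (p + h) <= t * (t ^+ 2 - q * r).
  rewrite -(ler_pM2r S_gt0); apply: le_trans leaf_parts.
  by rewrite [in leRHS]S1E; lra.
(* The product [q r] is replaced by a lower bound that is linear in the class sizes. *)
pose a := q + r - 1; have qra : a <= q * r.
  have : 0 <= (q - 1) * (r - 1) by rewrite mulr_ge0 // subr_ge0.
  by rewrite /a; lra.
have Pa : (t * (a + 1) + 2 * a) * (p + h) <= t * (t ^+ 2 - a).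
  have : 0 <= (q * r - a) * (t + 2 * (p + h)) by rewrite mulr_ge0; lra.
  by move: P; rewrite /a; lra.
(* For [a = 1] the bound [Pa] says exactly [D >= 0]; in general it gives
   [D >= (a - 1) (p + h - 1)]. *)
pose D := t ^+ 2 - t - 2 * (a + p + h - 1).
have a1 : 1 <= a by rewrite /a; lra.
have DP : (a - 1) * (p + h - 1) * (t + 2) <= D * (1 + t).
  by move: Pa; rewrite /D; lra.
have D1 : (a - 1) * (p + h - 1) <= D.
  have t1 : 0 < 1 + t by lra.
  rewrite -(ler_pM2r t1); apply: le_trans DP.
  have : 0 <= (a - 1) * (p + h - 1) by rewrite mulr_ge0; lra.
  by lra.
have D0 : 0 <= D by apply: le_trans D1; rewrite mulr_ge0; lra.
have s0 : 0 < s by lra.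
have hV : 2 <= h + h^-1.
  have : 0 <= (h - 1) ^+ 2 / h by rewrite divr_ge0 ?sqr_ge0 // ltW.
  by rewrite (_ : _ / h = h + h^-1 - 2) ?subr_ge0 //; field; rewrite gt_eqF.
have CL : l + 1 + h^-1 <= t ^+ 2 / s.
  rewrite -(ler_pM2r s0) divfK ?gt_eqF // -(ler_pM2r h0).
  rewrite (_ : (l + 1 + h^-1) * s * h = (l * s + s) * h + s); first by lra.
  by field; rewrite gt_eqF.
have tE : t ^+ 2 = s * (t ^+ 2 / s) by rewrite mulrC divfK // gt_eqF.
have hi0 : 0 < h^-1 by rewrite invr_gt0.
set w := t ^+ 2 / s in CL tE.
(* Here [2 h + 2 / h >= 4]; the excess over 1/2 comes from [D] when [s = 1] and from [(s - 1) l]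
   when [s >= 2]. *)
have gap : D + 2 * h + 2 * h^-1 - 4 + 2 * (s - 1) * l <=
    3 * t ^+ 2 - t - 2 * (l + s + p + q + r).
  have : 0 <= (s - 1) * (w - 1 - l) by rewrite mulr_ge0; lra.
  by rewrite /D /a; lra.
case: s12 => [es|s2].
  case: other => [|qr3]; first by lra.
  have a2 : 2 <= a by rewrite /a; lra.
  have Dh : h <= D.
    apply: le_trans D1; have : 0 <= (a - 2) * (p + h - 1) by rewrite mulr_ge0; lra.
    by lra.
  have h3 : 9 / 2 < 3 * h + 2 * h^-1.
    rewrite -subr_gt0 -(pmulr_lgt0 _ h0).
    rewrite (_ : (3 * h + 2 * h^-1 - 9 / 2) * h = 3 * h ^+ 2 - 9 / 2 * h + 2);
      last by field; rewrite gt_eqF.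
    have := sqr_ge0 (h - 3 / 4); lra.
  split; first by rewrite es in gap *; lra.
  have tt : 4 < t ^+ 2 - t by rewrite /D in D0 Dh; lra.
  exact: gap_of_sqr_sub.
have : 1 <= (s - 1) * l.
  have : 0 <= (s - 2) * l by rewrite mulr_ge0; lra.
  by lra.
by split; lra.
Qed.

End LeafSystem.

(** * Graphs with a neighbourhood that is a twin class *)

Lemma frame_form_off_v ta tb tc xi xa xb xc yi ya yb yc :
  frame_form ta tb tc (xi, false, xa, xb, xc) (yi, false, ya, yb, yc) =
  (xb%:Z + xc%:Z - xa%:Z) * ya%:Z + (xa%:Z + xc%:Z - xb%:Z) * yb%:Z
  + (xa%:Z + xb%:Z - xc%:Z) * yc%:Z.
Proof. by rewrite /frame_form -[Posz false]/(0 : int); ring. Qed.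

Section Leaf.
Variables (R : realType) (G : sgraph).
Hypotheses (conG : sg_connected G) (rk5 : graph_rank R G = 5).
Variables (i v a b c : G).
Hypothesis leaf : leaf_frame i v a b c.

(* Class 0 is that of [v], class 1 that of [i], and classes 2, 3, 4 are the parts
   of [a], [b], [c]. *)
Definition leaf_class (u : G) : nat :=
  (if adj u v then 1
  else if adj u a then (if adj u b then 4 else 3)
  else if adj u b then 2 else 0)%N.

Lemma leaf_class_lt5 u : (leaf_class u < 5)%N.
Proof. by rewrite /leaf_class; do 3?case: ifP. Qed.

Let cfg : pendant_triangle i v a b c. Proof. by case: leaf. Qed.

Let twin u : adj u v -> adj u =1 adj i. Proof. by case: leaf => _; apply. Qed.

Lemma leaf_class1 u : (leaf_class u == 1%N) = adj u v.
Proof. by rewrite /leaf_class; do 3?case: ifP. Qed.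

(** For [u] not adjacent to [v], isotropy on the triangle makes [u] adjacent to none or to exactly
    two of [a], [b], [c]. *)
Lemma leaf_classE u :
  signature i v a b c u =
  if leaf_class u == 1%N then signature i v a b c i
  else (adj u i, false, (leaf_class u == 3%N) || (leaf_class u == 4%N),
        (leaf_class u == 2%N) || (leaf_class u == 4%N),
        (leaf_class u == 2%N) || (leaf_class u == 3%N)).
Proof.
rewrite leaf_class1; case uv: (adj u v).
  by rewrite /signature !(twin uv).
have := frame_form_self conG rk5 u cfg; rewrite /signature uv frame_form_off_v.
rewrite /leaf_class uv.
by case: (adj u i); case: (adj u a); case: (adj u b); case: (adj u c).
Qed.

(** Seeing none of [v], [a], [b], [c], such a vertex must be adjacent to [i], and so has the
    signature of [v]. *)
Lemma adj_leaf_class0 u w : leaf_class u = 0%N -> adj u w = (leaf_class w == 1%N).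
Proof.
move=> u0; have [_ sv _ _ _] := frame_signature cfg.
have su := leaf_classE u; rewrite u0 /= in su.
have ui : adj u i.
  have := frame_form_self conG rk5 u cfg; rewrite su.
  by case: (adj u i).
rewrite leaf_class1 (adj_sym w); apply: (signature_inj rk5 cfg).
by rewrite su ui sv.
Qed.

Lemma adj_leaf_class1 u w : leaf_class u = 1%N -> adj u w = adj i w.
Proof. by move/eqP; rewrite leaf_class1 => /twin. Qed.

Lemma adj_leaf_class_parts u w : (1 < leaf_class u)%N -> (1 < leaf_class w)%N ->
  adj u w = (leaf_class u != leaf_class w).
Proof.
have n1 x : (1 < leaf_class x)%N -> (leaf_class x == 1%N) = false.
  by apply: contraTF => /eqP ->.
move=> u1 w1; have := adj_frame_form rk5 cfg u w.
rewrite (leaf_classE u) (leaf_classE w) !n1 // frame_form_off_v; move: u1 w1.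
have := leaf_class_lt5 u; have := leaf_class_lt5 w.
case: (leaf_class w) => [|[|[|[|[|]]]]] //= _;
by case: (leaf_class u) => [|[|[|[|[|]]]]] //= _; case: (adj u w).
Qed.

Variable x : G -> R.
Hypothesis x_gt0 : forall u, 0 < x u.
Let rho := spectral_radius R G.
Hypothesis x_eig : forall u, nbr_sum x u = rho * x u.

Definition class_sum k := \sum_(u | leaf_class u == k) x u.
Definition class_size k := #|[pred u | leaf_class u == k]|.

Let big5 (f : nat -> bool) (F : nat -> R) : \sum_(k < 5 | f k) F k =
  (f 0%N)%:R * F 0%N + (f 1%N)%:R * F 1%N + (f 2%N)%:R * F 2%N + (f 3%N)%:R * F 3%N
  + (f 4%N)%:R * F 4%N.
Proof.
rewrite big_mkcond !big_ord_recl big_ord0 /= [_ + 0]addr0 !addrA /bump /=.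
by do 4?[congr (_ + _)]; case: ifP => _; rewrite ?mul0r ?mul1r.
Qed.

Lemma sum_by_class (f : nat -> bool) (P : pred G) :
  (forall w, P w = f (leaf_class w)) ->
  \sum_(w | P w) x w = (f 0%N)%:R * class_sum 0%N + (f 1%N)%:R * class_sum 1%N
    + (f 2%N)%:R * class_sum 2%N + (f 3%N)%:R * class_sum 3%N
    + (f 4%N)%:R * class_sum 4%N.
Proof.
move=> Pf; rewrite -(big5 f class_sum); pose g u := Ordinal (leaf_class_lt5 u).
rewrite (partition_big g (fun k : 'I_5 => f k)) => [|w]; last by rewrite Pf.
apply: eq_bigr => k fk; apply: eq_bigl => w.
by rewrite Pf -val_eqE /=; case: eqP => [->|]; rewrite ?fk ?andbF.
Qed.

Lemma sum_le_nbr_sum (P : pred G) u : (forall w, P w -> adj u w) ->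
  \sum_(w | P w) x w <= rho * x u.
Proof.
move=> Pu; rewrite -x_eig /nbr_sum [leRHS](bigID P) /= ler_wpDr //.
  by apply: sumr_ge0 => w _; exact: ltW.
rewrite le_eqVlt; apply/orP; left; apply/eqP/eq_bigl => w.
by case Pw: (P w); rewrite ?andbF // Pu.
Qed.

Lemma class_sum_le k (m : R) :
  (forall u, leaf_class u = k -> m <= rho * x u) ->
  (class_size k)%:R * m <= rho * class_sum k.
Proof.
move=> mu; rewrite /class_sum mulr_sumr /class_size mulr_natl -sumr_const.
by apply: ler_sum => u /eqP/mu.
Qed.

Lemma leaf_class_frame : [/\ leaf_class v = 0%N, leaf_class i = 1%N,
  leaf_class a = 2%N, leaf_class b = 3%N & leaf_class c = 4%N].
Proof.
case/and5P: cfg => vi /negPf va /negPf vb /negPf vc /and3P[ab ac bc].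
rewrite /leaf_class !adj_irrefl !(adj_sym _ v) (adj_sym b a) (adj_sym c a) (adj_sym c b).
by rewrite vi va vb vc ab ac bc.
Qed.

Hypothesis ia : adj i a.

(** Vertices of the parts other than [a] may be adjacent to class 1 too. Those terms are dropped, so
    only the relations for class 0 and for [a] are equalities. *)
Lemma leaf_frame_system : leaf_system rho (class_size 0%N)%:R (class_size 1%N)%:R
  (class_size 2%N)%:R (class_size 3%N)%:R (class_size 4%N)%:R
  (class_sum 0%N) (class_sum 1%N) (x a) (class_sum 2%N) (class_sum 3%N) (class_sum 4%N).
Proof.
have [cv ci ca cb cc] := leaf_class_frame.
have sum_gt0 u : 0 < class_sum (leaf_class u).
  rewrite /class_sum (bigD1 u) //= ltr_pwDl //.
  by apply: sumr_ge0 => w _; exact: ltW.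
have size_ge1 u : 1 <= (class_size (leaf_class u))%:R :> R.
  by rewrite ler1n; apply/card_gt0P; exists u; rewrite inE.
have adj_av w : leaf_class w = 1%N -> adj w a.
  by move=> w1; rewrite (adj_leaf_class1 _ w1).
have adj_a w : adj a w = [|| leaf_class w == 3, leaf_class w == 4 | leaf_class w == 1]%N.
  have := leaf_class_lt5 w.
  case cw: (leaf_class w) => [|[|[|[|[|]]]]] //= _; rewrite adj_sym.
  - by rewrite (adj_leaf_class0 _ cw) ca.
  - exact: adj_av.
  - by rewrite adj_leaf_class_parts ?cw ?ca.
  - by rewrite adj_leaf_class_parts ?cw ?ca.
  - by rewrite adj_leaf_class_parts ?cw ?ca.
have Ea : rho * x a = class_sum 3%N + class_sum 4%N + class_sum 1%N.
  rewrite -x_eig /nbr_sum.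
  rewrite (sum_by_class (f := fun k => [|| k == 3, k == 4 | k == 1]%N)) //.
  by rewrite /=; ring.
have part u (f : nat -> bool) : (1 < leaf_class u)%N ->
    (forall k, f k -> (1 < k)%N && (k != leaf_class u)) ->
    (f 0%N)%:R * class_sum 0%N + (f 1%N)%:R * class_sum 1%N
    + (f 2%N)%:R * class_sum 2%N + (f 3%N)%:R * class_sum 3%N
    + (f 4%N)%:R * class_sum 4%N <= rho * x u.
  move=> u1 fk; rewrite -(sum_by_class (f := f) (P := fun w => f (leaf_class w))) //.
  apply: sum_le_nbr_sum => w /fk/andP[w1 wu].
  by rewrite adj_leaf_class_parts // eq_sym.
split.
- have := sum_gt0 b; have := sum_gt0 c; have := sum_gt0 i.
  rewrite ci cb cc => s1 s4 s3; have : 0 < rho * x a by rewrite Ea !addr_gt0.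
  by rewrite pmulr_lgt0.
- by rewrite -ci.
- by rewrite -cv.
- by rewrite -ca.
- by rewrite -cb.
- by rewrite -cc.
- by rewrite -ci.
- by rewrite -ca.
- by rewrite -cb.
- by rewrite -cc.
- rewrite {1}/class_sum mulr_sumr mulr_natl /class_size -sumr_const.
  apply: eq_bigr => u /eqP u0; rewrite -x_eig /nbr_sum.
  by apply: eq_bigl => w; rewrite (adj_leaf_class0 _ u0).
- apply: class_sum_le => u u1.
  have -> : class_sum 0%N + x a = \sum_(w | (leaf_class w == 0%N) || (w == a)) x w.
    rewrite (bigD1 a) /= ?eqxx ?orbT // addrC; congr (_ + _).
    apply: eq_bigl => w; case: (eqVneq w a) => [->|_]; first by rewrite ca.
    by rewrite orbF andbT.
  apply: sum_le_nbr_sum => w; rewrite (adj_leaf_class1 _ u1) => /orP[/eqP w0|/eqP->//].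
  by rewrite adj_sym (adj_leaf_class0 _ w0) ci.
- exact: Ea.
- have -> : class_sum 2%N = x a + \sum_(u | (leaf_class u == 2%N) && (u != a)) x u.
    by rewrite /class_sum (bigD1 a) ?ca.
  rewrite [leRHS]mulrDr Ea mulr_sumr.
  have -> : (class_size 2%N)%:R * (class_sum 3%N + class_sum 4%N) + class_sum 1%N =
     class_sum 3%N + class_sum 4%N + class_sum 1%N +
     \sum_(u | (leaf_class u == 2%N) && (u != a)) (class_sum 3%N + class_sum 4%N).
    rewrite /class_size mulr_natl -sumr_const (bigD1 a) /= ?inE ?ca //.
    by rewrite addrAC.
  rewrite lerD2l; apply: ler_sum => u /andP[/eqP u2 _].
  have := part u (fun k => (k == 3) || (k == 4))%N; rewrite u2 /=.
  rewrite !mul0r !mul1r !add0r; apply=> //.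
  by move=> k /orP[]/eqP->.
- apply: class_sum_le => u u3.
  have := part u (fun k => (k == 2) || (k == 4))%N; rewrite u3 /=.
  rewrite !mul0r !mul1r !add0r addr0; apply=> //.
  by move=> k /orP[]/eqP->.
- apply: class_sum_le => u u4.
  have := part u (fun k => (k == 2) || (k == 3))%N; rewrite u4 /=.
  rewrite !mul0r !mul1r !add0r addr0; apply=> //.
  by move=> k /orP[]/eqP->.
Qed.
End Leaf.

(** * Choice of the multiplicities *)

Section Feasible.
Variable R : realType.
Implicit Types n t k f q : R.

(* For [n = k + l + 4] these are [t^2 - l - 1] and [(t^2 - t) / 2 - k - 1]; their
   product is 1 at the spectral radius [t] of G10 o (1,1,1,1,k,l), and both
   increase with [t]. *)
Definition capX n t k := t ^+ 2 - n + 3 + k.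
Definition capZ t k := (t ^+ 2 - t) / 2 - 1 - k.

(** For [0 < t] and [4 + k < n], these conditions put the spectral radius of G10 o (1,1,1,1,k,n-k-4)
    at most, respectively below, [t]. *)
Definition feasible n t k := (0 < capX n t k) && (1 <= capX n t k * capZ t k).
Definition sfeasible n t k := (0 < capX n t k) && (1 < capX n t k * capZ t k).

(** By the arithmetic-geometric mean inequality, as the factors have sum
    [(3 t^2 - t) / 2 - n + 2]. *)
Lemma feasible_ge n t k : feasible n t k -> 2 * n <= 3 * t ^+ 2 - t.
Proof.
case/andP=> X0 XZ; have Z0 : 0 < capZ t k.
  by rewrite -(pmulr_rgt0 _ X0) (lt_le_trans ltr01).
have : 2 <= capX n t k + capZ t k.
  move: X0 XZ Z0; move: (capX n t k) (capZ t k) => X Z X0 XZ Z0.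
  rewrite leNgt; apply/negP => XZ2.
  have := sqr_ge0 (X - Z).
  have : 0 < (2 - X - Z) * (2 + X + Z) by rewrite mulr_gt0; lra.
  by lra.
by rewrite /capX /capZ; lra.
Qed.

Lemma root_le n t q : 1 <= q -> q ^+ 2 = 24 * n + 1 -> 0 < t ->
  2 * n <= 3 * t ^+ 2 - t -> 1 + q <= 6 * t.
Proof.
move=> q1 qq t0 tn; rewrite leNgt; apply/negP => tq.
have : 0 < (1 + q - 6 * t) * (q + 6 * t - 1) by rewrite mulr_gt0; lra.
by lra.
Qed.

(* The paper's alpha, with [q] for the square root of [24 n + 1]. *)
Definition optimum n q := (6 * n - 37 - q) / 18.

(** Both factors equal 1 at [t = (1 + q) / 6], the positive root of [3 t^2 - t = 2 n], and grow from
    there. *)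
Lemma optimum_cap n t q : 5 <= q -> q ^+ 2 = 24 * n + 1 -> 0 < t ->
  2 * n <= 3 * t ^+ 2 - t ->
  1 <= capX n t (optimum n q) /\ 1 <= capZ t (optimum n q).
Proof.
move=> q5 qq t0 tn; have q1 : 1 <= q by lra.
have tq := root_le q1 qq t0 tn.
have h : 0 <= (6 * t - (1 + q)) * (6 * t + (1 + q) - 6) by rewrite mulr_ge0; lra.
have h' : 0 <= (6 * t - (1 + q)) * (6 * t + (1 + q)) by rewrite mulr_ge0; lra.
by rewrite /capX /capZ /optimum; split; lra.
Qed.

(* [k |-> capX n t k * capZ t k] is concave quadratic. *)
Lemma capXZ_convex n t k f m :
  (m - k) * (capX n t f * capZ t f) =
  (m - f) * (capX n t k * capZ t k) + (f - k) * (capX n t m * capZ t m)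
  + (m - f) * (f - k) * (m - k).
Proof. by rewrite /capX /capZ; field. Qed.

(** By concavity in [k]: the product is at least 1 at [k] and exceeds 1 at the optimum [m], hence
    exceeds 1 at [f]. *)
Lemma sfeasible_between n t q k f (m := optimum n q) :
  5 <= q -> q ^+ 2 = 24 * n + 1 -> 0 < t -> feasible n t k ->
  (k < f <= m) || (m <= f < k) -> sfeasible n t f.
Proof.
move=> q5 qq t0 feask kfm; have [Xm Zm] := optimum_cap q5 qq t0 (feasible_ge feask).
rewrite -/m in Xm Zm; case/andP: feask => Xk Pk.
have km : k != m by apply/eqP => km; case/orP: kfm => /andP[]; lra.
have Xf : 0 < capX n t f by move: Xk Xm; rewrite /capX; case/orP: kfm => /andP[]; lra.
rewrite /sfeasible Xf /=.
(* Were both factors 1 at [m], the product at [k] would be [1 - (m - k)^2]. *)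
have Pm : 1 < capX n t m * capZ t m.
  rewrite ltNge; apply/negP => Pm1.
  have Xm1 : capX n t m = 1.
    apply/eqP; rewrite eq_le Xm andbT; apply: le_trans Pm1.
    by rewrite ler_peMr //; lra.
  have Zm1 : capZ t m = 1.
    by apply/eqP; rewrite eq_le Zm andbT; move: Pm1; rewrite Xm1 mul1r.
  have Xk1 : capX n t k = 1 - (m - k) by move: Xm1; rewrite /capX; lra.
  have Zk1 : capZ t k = 1 + (m - k) by move: Zm1; rewrite /capZ; lra.
  have : 0 < (m - k) ^+ 2 by rewrite lt_def sqrf_eq0 subr_eq0 eq_sym km sqr_ge0.
  by move: Pk; rewrite Xk1 Zk1; lra.
have := capXZ_convex n t k f m.
move: Pk Pm; set A := capX n t k * _; set B := capX n t m * _.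
set C := capX n t f * _ => Ak Bm E.
case/orP: kfm => /andP[h1 h2].
  have mk : 0 < m - k by lra.
  rewrite -(ltr_pM2l mk) mulr1 E.
  have : 0 <= (m - f) * (A - 1) by rewrite mulr_ge0; lra.
  have : 0 < (f - k) * (B - 1) by rewrite mulr_gt0; lra.
  have : 0 <= (m - f) * (f - k) * (m - k) by rewrite !mulr_ge0; lra.
  by lra.
have mk : 0 < k - m by lra.
rewrite -(ltr_pM2l mk) mulr1 (_ : (k - m) * C = - ((m - k) * C)); last by ring.
rewrite E.
have : 0 <= (f - m) * (A - 1) by rewrite mulr_ge0; lra.
have : 0 < (k - f) * (B - 1) by rewrite mulr_gt0; lra.
have : 0 <= (f - m) * (k - f) * (k - m) by rewrite !mulr_ge0; lra.
by lra.
Qed.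

Lemma capXZ_succ n t k :
  capX n t k * capZ t k - capX n t (k + 1) * capZ t (k + 1) =
  (t ^+ 2 + t) / 2 - n + 5 + 2 * k.
Proof. by rewrite /capX /capZ; field. Qed.

Lemma caps_lt n t t1 k : 1 < t + t1 -> 0 < t -> t < t1 ->
  capX n t k < capX n t1 k /\ capZ t k < capZ t1 k.
Proof.
move=> s1 t0 tt1.
have H1 : 0 < (t1 - t) * (t + t1) by rewrite mulr_gt0; lra.
have H2 : 0 < (t1 - t) * (t + t1 - 1) by rewrite mulr_gt0; lra.
by rewrite /capX /capZ; split; lra.
Qed.

Lemma capX_gt0_gt1 n t k : 0 < t -> 4 + k < n -> 0 < capX n t k -> 1 < t.
Proof.
rewrite /capX => t0 kn X0; rewrite ltNge; apply/negP => t1.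
have : 0 <= (1 - t) * (1 + t) by rewrite mulr_ge0; lra.
by lra.
Qed.

Section Root.
Variables (n t k : R).
Hypotheses (t_gt0 : 0 < t) (k_lt : 4 + k < n) (X_gt0 : 0 < capX n t k)
  (XZ1 : capX n t k * capZ t k = 1).

Lemma feasible_root_le t1 : 0 < t1 -> feasible n t1 k -> t <= t1.
Proof.
move=> t10 /andP[X1 P1]; rewrite leNgt; apply/negP => t1t.
have tgt := capX_gt0_gt1 t_gt0 k_lt X_gt0.
have [XX ZZ] : capX n t1 k < capX n t k /\ capZ t1 k < capZ t k.
  by apply: caps_lt; lra.
suff : capX n t1 k * capZ t1 k < capX n t k * capZ t k by rewrite XZ1 ltNge P1.
apply: ltr_pM => //; first exact: ltW.
by rewrite -(pmulr_rge0 _ X1) (le_trans ler01).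
Qed.

Lemma sfeasible_root_lt t1 : 0 < t1 -> sfeasible n t1 k -> t < t1.
Proof.
move=> t10 sf; have /andP[_ P1] := sf; rewrite lt_def feasible_root_le //.
  by rewrite andbT; apply: contraTneq P1 => ->; rewrite XZ1 ltxx.
by case/andP: sf => X1 /ltW P; apply/andP.
Qed.

End Root.

(** The margin 1/2 leaves room for an integer [k] from order 7 on; order 6 needs the bound 27/2. *)
Lemma sfeasible_exists (n : nat) t : (6 <= n)%N -> 0 < t ->
  2 * n%:R + 1 / 2 < 3 * t ^+ 2 - t -> 27 / 2 < 3 * t ^+ 2 - t ->
  exists2 k : nat, (k + 5 <= n)%N & sfeasible n%:R t k%:R.
Proof.
rewrite leq_eqVlt => /orP[/eqP<- t0 _ t27|n7 t0 tn _].
  (* At 16/7 the value of [3 t^2 - t] is still below 27/2, but the factors for [k = 0] already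
     multiply to more than 1. *)
  exists 0%N => //; have t2 : 16 / 7 < t.
    rewrite ltNge; apply/negP => t2.
    have : 0 <= (16 / 7 - t) * (t + 16 / 7 - 1 / 3) \/ t < 1 by
      case: (ltP t 1) => h; [right|left; rewrite mulr_ge0; lra].
    case=> [|t1]; first by lra.
    have : 0 < (1 - t) * (t + 1) by rewrite mulr_gt0; lra.
    by lra.
  have T2 : 0 < (t - 16 / 7) * (t + 16 / 7) by rewrite mulr_gt0; lra.
  have T3 : 0 < (t - 16 / 7) * (t + 9 / 7) by rewrite mulr_gt0; lra.
  have X1 : 20 / 9 < capX 6 t 0 by rewrite /capX; lra.
  have Z1 : 7 / 15 < capZ t 0 by rewrite /capZ; lra.
  rewrite /sfeasible; apply/andP; split; first lra.
  by nra.
have nR : 7 <= n%:R :> R by rewrite ler_nat.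
(* [(1 + r) / 6] is the positive root of [3 t^2 - t = 2 n + 1 / 2], where the factors have sum
   9/4. *)
pose r : R := Num.sqrt (24 * n%:R + 7); have r0 : 0 <= r := sqrtr_ge0 _.
have rr : r ^+ 2 = 24 * n%:R + 7 by rewrite sqr_sqrtr; lra.
have r13 : 66 / 5 < r.
  rewrite ltNge; apply/negP => h.
  have : 0 <= (66 / 5 - r) * (66 / 5 + r) by rewrite mulr_ge0; lra.
  by lra.
pose t1 := (1 + r) / 6; have t1t : t1 < t.
  rewrite ltNge /t1; apply/negP => h.
  have : 0 <= ((1 + r) / 6 - t) * ((1 + r) / 6 + t - 1 / 3) by rewrite mulr_ge0; lra.
  by lra.
have E1 : 3 * t1 ^+ 2 - t1 = 2 * n%:R + 1 / 2 by rewrite /t1; lra.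
have t1g : 7 / 3 < t1 by rewrite /t1; lra.
pose U := (t1 ^+ 2 - t1) / 2 - 1.
have U0 : 0 <= U - 11 / 18.
  have : 0 < (t1 - (1 + 66 / 5) / 6) * (t1 + (1 + 66 / 5) / 6 - 1).
    by rewrite mulr_gt0 /t1; lra.
  by rewrite /U; lra.
have /andP[k1 k2] := truncn_itv U0; set k := Num.truncn _ in k1 k2.
rewrite -natr1 in k2; have k0 : 0 <= k%:R :> R by [].
have X1 : capX n%:R t1 k%:R = 9 / 4 - capZ t1 k%:R by rewrite /capX /capZ; lra.
have Z1 : 11 / 18 <= capZ t1 k%:R < 29 / 18.
  by rewrite /capZ -/U; apply/andP; split; lra.
have kn : (k + 5 <= n)%N.
  rewrite addnS -addn1 addn1 -(ltr_nat R) natrD; case/andP: Z1 => z1 z2.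
  have : 0 < (t1 - 7 / 3) * (t1 + 7 / 3) by rewrite mulr_gt0; lra.
  by move: X1; rewrite {1}/capX; lra.
exists k => //; case/andP: Z1 => z1 z2.
have [] := @caps_lt n%:R t1 t k%:R _ _ t1t; [lra|lra|].
move: X1 z1 z2; set z := capZ t1 _; set x := capX _ t1 _.
set z' := capZ t _; set x' := capX _ t _ => X1 z1 z2 XX ZZ.
have xz : 1 < x * z.
  have : 0 <= (z - 11 / 18) * (29 / 18 - z) by rewrite mulr_ge0; lra.
  by rewrite X1; lra.
rewrite /sfeasible -/x' -/z'; apply/andP; split; first lra.
by apply: lt_trans xz _; apply: ltr_pM => //; lra.
Qed.

End Feasible.

Section BestK.
Variable R : realType.

Let q (n : nat) : R := Num.sqrt (24 * n%:R + 1).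

Let qq n : q n ^+ 2 = 24 * n%:R + 1.
Proof. by rewrite /q sqr_sqrtr // addr_ge0 // mulr_ge0. Qed.

Let q_ge (n c : nat) : (c ^ 2 <= 24 * n + 1)%N -> c%:R <= q n.
Proof.
move=> h; rewrite -(ler_pXn2r (n := 2)) ?nnegrE ?sqrtr_ge0 // qq.
by rewrite -natrX -natrM natr1 ler_nat; move: h; rewrite addn1.
Qed.

(** The exponent of 5 is even on the left and odd on the right. *)
Lemma no_square_5 (x y : nat) : (x ^ 2 = 5 * y ^ 2)%N -> y = 0%N.
Proof.
move=> xy; apply/eqP; rewrite -leqn0 leqNgt; apply/negP => y0.
have /(congr1 (fun m => odd (logn 5 m))) := xy.
by rewrite lognM ?expn_gt0 ?y0 // !lognX (@logn_prime 5 5) // oddD !mul2n !odd_double.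
Qed.

(** [w] is the golden ratio minus 1; the relation would give [(2 b + a)^2 = 5 a^2]. *)
Lemma golden_irrational (w : R) (a b : int) : 0 < w -> w ^+ 2 + w = 1 ->
  a%:~R * w = b%:~R -> a = 0.
Proof.
move=> w0 w1 aw.
have E : (2 * b + a) ^+ 2 = 5 * a ^+ 2 :> int.
  apply: (@intr_inj R); rewrite !(rmorphD, rmorphM, rmorphXn, rmorph_nat) /= -aw.
  transitivity (a%:~R ^+ 2 * (4 * (w ^+ 2 + w) + 1) : R); first by ring.
  by rewrite w1; ring.
apply/eqP; rewrite -absz_eq0; apply/eqP.
apply: (@no_square_5 (absz (2 * b + a))).
by rewrite -!abszX E abszM.
Qed.

(** A tie forces [capZ = w + 1] and [w^2 + w = 1], and [t] is an integer minus [w]. *)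
Lemma caps_no_tie (n k : nat) (t : R) : 0 < t -> 0 < capX n%:R t k%:R ->
  capX n%:R t k%:R * capZ t k%:R = 1 ->
  capX n%:R t (k%:R + 1) * capZ t (k%:R + 1) = 1 -> False.
Proof.
move=> t0; set w := capX n%:R t k%:R => w0 P0 P1.
have ZE : capZ t k%:R = w + 1.
  move: P0 P1; rewrite (_ : capX _ _ (_ + 1) = w + 1); last by rewrite /w /capX; ring.
  rewrite (_ : capZ t (_ + 1) = capZ t k%:R - 1); last by rewrite /capZ; ring.
  by lra.
have w1 : w ^+ 2 + w = 1 by move: P0; rewrite ZE; lra.
have tE : t = n%:R - 7 - 3 * k%:R - w.
  by move: ZE; rewrite /w /capX /capZ; lra.
pose N : int := n%:Z - 7 - 3 * k%:Z.
have NE : N%:~R = n%:R - 7 - 3 * k%:R :> R.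
  by rewrite /N !(rmorphD, rmorphB, rmorphN, rmorphM) /= -!pmulrn.
(* Two expressions for [t^2] give an integer relation linear in [w], so [2 N + 2 = 0]; then
   [t = - 1 - w] is negative. *)
have /(golden_irrational w0 w1) N0 :
    (2 * N + 2)%:~R * w = (N ^+ 2 + 1 - n%:Z + 3 + k%:Z)%:~R.
  rewrite !(rmorphD, rmorphB, rmorphN, rmorphM, rmorphXn) /= -!pmulrn.
  have : t ^+ 2 = w + n%:R - 3 - k%:R by rewrite /w /capX; ring.
  by rewrite tE -NE; lra.
have N1 : N = -1 by lia.
by move: tE; rewrite -NE N1 => tE; lra.
Qed.

(** The product at 0 exceeds that at 1 by [(t^2 + t) / 2 - n + 5], positive for [t > n - 15 / 2]
    because [3 t^2 - t >= 2 n]. *)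
Lemma feasible_one_zero (n : nat) (t : R) : (n <= 10)%N -> 0 < t ->
  feasible n%:R t 1 -> sfeasible n%:R t 0.
Proof.
move=> n10 t0 f1; have tn := feasible_ge f1; case/andP: f1 => X1 P1.
have q1 : 1 <= q n by rewrite -[1]/(1%:R) q_ge // addn1.
have tq := root_le q1 (qq n) t0 tn.
have ct : n%:R - 15 / 2 < t.
  have [n9|] := leqP n 9.
    have [n8|n8] := leqP n 8.
      have := n8; rewrite -(ler_nat R) => n8R.
      have [n7|n7] := leqP n 7.
        by have := n7; rewrite -(ler_nat R) => n7R; lra.
      have n8e : n = 8 by lia.
      have q2 : 13%:R <= q n by apply: q_ge; rewrite n8e.
      by lra.
    have n9e : n = 9 by lia.
    have q2 : 14%:R <= q n by apply: q_ge; rewrite n9e.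
    by rewrite n9e in tn *; lra.
  move=> n9; have n10e : n = 10 by lia.
  have q2 : 15%:R <= q n by apply: q_ge; rewrite n10e.
  by rewrite n10e in tn *; lra.
have S := capXZ_succ n%:R t 0; rewrite add0r in S.
have P0 : 1 < capX n%:R t 0 * capZ t 0 by lra.
have Z0 : 0 < capZ t 0.
  have Z1 : 0 < capZ t 1 by rewrite -(pmulr_rgt0 _ X1) (lt_le_trans ltr01).
  by move: Z1; rewrite /capZ; lra.
by rewrite /sfeasible P0 andbT -(pmulr_lgt0 _ Z0) (lt_trans ltr01).
Qed.

(** The optimum is below 1, so larger [k] reduce to 1, which loses to 0. *)
Lemma best_k_le10 (n k : nat) (t : R) : (6 <= n <= 10)%N -> (0 < k)%N -> 0 < t ->
  feasible n%:R t k%:R -> sfeasible n%:R t 0.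
Proof.
case/andP=> n6 n10 k0 t0 fk; apply: feasible_one_zero => //.
move: k0 fk; rewrite leq_eqVlt => /orP[/eqP<-//|k1 fk].
have q12 : 12%:R <= q n by apply: q_ge; lia.
have := n10; rewrite -(ler_nat R) => n10R.
have := k1; rewrite -(ltr_nat R) => k1R.
have /andP[X /ltW P] : sfeasible n%:R t 1.
  apply: (@sfeasible_between _ _ _ (q n) k%:R) => //; first lra.
  by apply/orP; right; rewrite k1R andbT /optimum; lra.
by apply/andP.
Qed.

(** The optimum is below 1, which settles [k >= 2]. Against [k = 0], the product increases from 0 to
    1 if [t < 3], and is at least 2 at 1 if [t >= 3]. *)
Lemma best_k_11 (k : nat) (t : R) : k != 1%N -> 0 < t ->
  feasible 11 t k%:R -> sfeasible 11 t 1.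
Proof.
move=> k1 t0 fk; have [k0|k0] := posnP k; last first.
  have {}k1 : (1 < k)%N by lia.
  have := k1; rewrite -(ltr_nat R) => k1R.
  have q16 : 16%:R <= q 11 by exact: q_ge.
  apply: (@sfeasible_between _ _ _ (q 11) k%:R) => //; first lra.
  by apply/orP; right; rewrite k1R andbT /optimum; lra.
rewrite {}k0 in fk; case/andP: fk => X0 P0.
have X1 : 0 < capX 11 t 1 by move: X0; rewrite /capX; lra.
rewrite /sfeasible X1 /=; have [t3|t3] := leP 3 t.
  have h1 : 0 <= (t - 3) * (t + 3) by rewrite mulr_ge0; lra.
  have h2 : 0 <= (t - 3) * (t + 2) by rewrite mulr_ge0; lra.
  have h3 : 2 <= capX 11 t 1 by rewrite /capX; lra.
  have h4 : 1 <= capZ t 1 by rewrite /capZ; lra.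
  have : 0 <= (capX 11 t 1 - 2) * capZ t 1 by rewrite mulr_ge0; lra.
  by lra.
have S := capXZ_succ 11 t 0; rewrite add0r in S.
have : 0 < (3 - t) * (t + 4) by rewrite mulr_gt0; lra.
by lra.
Qed.

(** [sfeasible_between] with the floor and the ceiling of [alpha] as intermediate points;
    [c + 5 <= n] keeps at least one leaf. *)
Lemma best_k_ge12 (n : nat) : (12 <= n)%N -> exists f c : nat,
  [/\ f%:Z = Num.floor (alpha R n), c%:Z = Num.ceil (alpha R n), (c + 5 <= n)%N,
      c = f \/ c = f.+1
    & forall (k : nat) (t : R), 0 < t -> feasible n%:R t k%:R ->
        ((k < f)%N -> sfeasible n%:R t f%:R) /\
        ((c < k)%N -> sfeasible n%:R t c%:R)].
Proof.
move=> n12; have := n12; rewrite -(ler_nat R) => n12R.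
have aE : alpha R n = optimum n%:R (q n) by [].
have q0 : 0 <= q n := sqrtr_ge0 _.
have q17 : 17%:R <= q n by apply: q_ge; lia.
have a0 : 0 <= alpha R n.
  rewrite aE /optimum; suff : q n <= 6 * n%:R - 37 by lra.
  rewrite leNgt; apply/negP => qn.
  have : 0 < (q n - (6 * n%:R - 37)) * (q n + (6 * n%:R - 37)) by rewrite mulr_gt0; lra.
  have nn : 0 <= (n%:R - 12) * (n%:R - 1) :> R by apply: mulr_ge0; lra.
  by have := qq n; lra.
have an : alpha R n <= n%:R / 3 - 3 by rewrite aE /optimum; lra.
have /andP[f1 f2] := truncn_itv a0; set f := Num.truncn _ in f1 f2.
have fl : f%:Z = Num.floor (alpha R n).
  by apply/esym/floor_def; rewrite intrD -!pmulrn f1 natr1.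
have between (k g : nat) (t : R) : 0 < t -> feasible n%:R t k%:R ->
    (k%:R < (g%:R : R) <= alpha R n) || (alpha R n <= (g%:R : R) < k%:R) -> sfeasible n%:R t g%:R.
  have q5 : 5 <= q n by lra.
  by rewrite aE => t0 fk kg; exact: (sfeasible_between q5 (qq n) t0 fk kg).
have [fa|fa] := eqVneq f%:R (alpha R n).
  exists f, f; split=> //.
  - by apply/esym/ceil_def; rewrite intrB -!pmulrn fa lexx ltrBlDr ltrDl ltr01.
  - rewrite -(ler_nat R) natrD fa; lra.
  - by left.
  - move=> k t t0 fk; split=> h; apply: (between k) => //; apply/orP.
      by left; rewrite ltr_nat h f1.
    by right; rewrite ltr_nat h fa lexx.
exists f, f.+1; split=> //.
- apply/esym/ceil_def; rewrite intrB -!pmulrn -natr1 addrK natr1 (ltW f2) andbT.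
  by rewrite lt_neqAle fa f1.
- rewrite -(ler_nat R) natrD -natr1; lra.
- by right.
- move=> k t t0 fk; split=> h; apply: (between k) => //; apply/orP.
    by left; rewrite ltr_nat h f1.
  by right; rewrite ltr_nat h (ltW f2).
Qed.

End BestK.

(** * Blowups *)

(** Isomorphism with H o m, phrased through a class map. Fibres may be empty, so that [k = 0] is
    covered. *)
Definition blowup_of (H : sgraph) (m : H -> nat) (G : sgraph) :=
  exists cls : G -> H, (forall k, #|[pred u | cls u == k]| = m k) /\
    forall u w, adj u w = adj (cls u) (cls w).

Lemma multiply_fiber_card (H : sgraph) (m : H -> nat) k :
  #|[pred u : multiply H m | tag u == k]| = m k.
Proof.
rewrite -[RHS]card_ord.
have inj : injective (fun j : 'I_(m k) => Tagged (fun k => 'I_(m k)) j).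
  by move=> j1 j2 /eqP; rewrite eq_Tagged /= => /eqP.
rewrite -(card_image inj); apply: eq_card => -[k' j]; rewrite !inE /=.
apply/eqP/imageP => [e|[j' _ [e _]]]; last by rewrite e.
by move: j; rewrite e => j; exists j.
Qed.

Lemma multiply_blowup (H : sgraph) (m : H -> nat) : blowup_of m (multiply H m).
Proof. by exists (@tag _ _); split=> // k; exact: multiply_fiber_card. Qed.

Lemma blowup_card (H : sgraph) (m : H -> nat) (G : sgraph) :
  blowup_of m G -> #|G| = (\sum_k m k)%N.
Proof.
case=> cls [cm _]; rewrite -sum1_card (partition_big cls predT) //=.
by apply: eq_bigr => k _; rewrite -cm -sum1_card.
Qed.

(** Fibres of equal size are matched along their enumerations; the default [y0] is never reached. *)
Lemma blowup_iso (H : sgraph) (m : H -> nat) (G G' : sgraph) :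
  blowup_of m G -> blowup_of m G' -> (0 < #|G'|)%N -> sg_iso G G'.
Proof.
move=> bG bG' /card_gt0P[y0 _]; have cGG' : #|G| = #|G'|.
  by rewrite (blowup_card bG) (blowup_card bG').
case: bG => cls [cm ca]; case: bG' => cls' [cm' ca'].
pose e k := enum [pred u | cls u == k]; pose e' k := enum [pred u | cls' u == k].
pose f u := nth y0 (e' (cls u)) (index u (e (cls u))).
have u_in u : u \in e (cls u) by rewrite mem_enum inE.
have lt_u u : (index u (e (cls u)) < size (e' (cls u)))%N.
  by rewrite -cardE cm' -cm cardE index_mem.
have cf u : cls' (f u) = cls u.
  by have := mem_nth y0 (lt_u u); rewrite mem_enum inE => /eqP.
have finj : injective f.
  move=> u w fuw; have cuw : cls u = cls w by rewrite -!cf fuw.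
  have /eqP := fuw; rewrite /f -cuw nth_uniq ?enum_uniq //; last first.
    by have := lt_u w; rewrite -cuw.
  move/eqP/(congr1 (nth u (e (cls u)))); rewrite nth_index // nth_index //.
  by rewrite cuw.
exists f; last by move=> u w; rewrite ca' !cf -ca.
by apply: inj_card_bij => //; rewrite cGG'.
Qed.

Definition pendant_sizes (k l : nat) : G10 -> nat :=
  tnth [tuple 1; 1; 1; 1; k; l]%N.

(** Neighbour lists numbered from 0, on plain numbers so that adjacency computes. Vertices 0, 1, 2
    play [a], [b], [c], 3 plays [i], 5 plays [v], and 4 is the rest of the part of [a]. *)
Definition g10_adj (j k : nat) : bool :=
  k \in nth [::] [:: [:: 1; 2; 3]; [:: 0; 2; 4]; [:: 0; 1; 4]; [:: 0; 5]; [:: 1; 2]; [:: 3]]%N j.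

Lemma g10_adjE (j k : G10) : adj j k = g10_adj j k.
Proof.
by case: j => [[|[|[|[|[|[|//]]]]]] ?]; case: k => [[|[|[|[|[|[|//]]]]]] ?].
Qed.

(** Deleting the fifth vertex of G10 leaves G1, embedded by [g]. *)
Lemma G1_blowup (l : nat) :
  blowup_of (pendant_sizes 0 l) (multiply G1 (tnth [tuple 1; 1; 1; 1; l]%N)).
Proof.
pose g (j : G1) : G10 := inord (nth 0 [:: 0; 1; 3; 2; 5] j)%N.
exists (fun u => g (tag u)); split=> [k|u w]; last first.
  rewrite g10_adjE -[adj u w]/(adj (tag u) (tag w)).
  case: (tag u) => [[|[|[|[|[|//]]]]] ?]; case: (tag w) => [[|[|[|[|[|//]]]]] ?];
  by rewrite /g !inordK.
have gE (j : G1) : g j = k ->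
    #|[pred u : multiply G1 (tnth [tuple 1; 1; 1; 1; l]%N) | g (tag u) == k]|
    = tnth [tuple 1; 1; 1; 1; l]%N j.
  move=> gj; rewrite -multiply_fiber_card; apply: eq_card => u; rewrite !inE -gj.
  apply/eqP/eqP => [|->//]; move: (tag u) => i /(congr1 val) /=.
  case: i => [[|[|[|[|[|//]]]]] ?]; case: {gj} j => [[|[|[|[|[|//]]]]] ?];
  by rewrite /g !inordK //= => _; apply/val_inj.
have [/eqP k4|k4] := boolP (val k == 4%N).
  rewrite /pendant_sizes (tnth_nth 0%N) k4 /=; apply: eq_card0 => u; rewrite !inE.
  apply/eqP => /(congr1 val); rewrite k4.
  by case: (tag u) => [[|[|[|[|[|//]]]]] ?]; rewrite /g /= inordK.
case: k gE k4 => [[|[|[|[|[|[|//]]]]]] k6] gE // _.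
- by rewrite (gE (Ordinal (isT : 0 < 5)%N)) ?/g; [|apply/val_inj; rewrite /= inordK].
- by rewrite (gE (Ordinal (isT : 1 < 5)%N)) ?/g; [|apply/val_inj; rewrite /= inordK].
- by rewrite (gE (Ordinal (isT : 3 < 5)%N)) ?/g; [|apply/val_inj; rewrite /= inordK].
- by rewrite (gE (Ordinal (isT : 2 < 5)%N)) ?/g; [|apply/val_inj; rewrite /= inordK].
- by rewrite (gE (Ordinal (isT : 4 < 5)%N)) ?/g; [|apply/val_inj; rewrite /= inordK].
Qed.

Section PendantBlowup.
Variables (R : realType) (G : sgraph) (k l : nat).
Hypotheses (bG : blowup_of (pendant_sizes k l) G) (l_gt0 : (0 < l)%N).

Lemma pendant_blowup_card : #|G| = (k + l + 4)%N.
Proof.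
rewrite (blowup_card bG) !big_ord_recl big_ord0 /pendant_sizes !(tnth_nth 0%N) /=.
by rewrite addn0 [RHS]addnC.
Qed.

(** Class 4 is empty for [k = 0], so no representative of it is promised. *)
Let reps : exists (cls : G -> nat) (rep : nat -> G),
  [/\ forall u w, adj u w = g10_adj (cls u) (cls w), forall u, (cls u < 6)%N,
      forall j, (j < 6)%N -> #|[pred u | cls u == j]| = nth 0%N [:: 1; 1; 1; 1; k; l]%N j
    & forall j, (j < 6)%N -> j != 4%N -> cls (rep j) = j].
Proof.
case: bG => cls [cm ca]; pose c u : nat := cls u.
have cE j : (j < 6)%N -> #|[pred u | c u == j]| = nth 0%N [:: 1; 1; 1; 1; k; l]%N j.
  move=> j6; transitivity (pendant_sizes k l (Ordinal j6)).
    by rewrite -cm; apply: eq_card => u; rewrite !inE.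
  by rewrite /pendant_sizes (tnth_nth 0%N).
have [u0 _] : exists u0 : G, true.
  have /card_gt0P[u _] : (0 < #|G|)%N by rewrite pendant_blowup_card addn4.
  by exists u.
exists c, (fun j => odflt u0 [pick u | c u == j]); split=> // [u w|u|j j6 j4].
- by rewrite ca g10_adjE.
- exact: (ltn_ord (cls u : 'I_6)).
- case: pickP => [u /eqP//|no]; have := cE _ j6; rewrite (eq_card0 no).
by case: j j6 j4 {no} => [|[|[|[|[|[|//]]]]]] //= _ _ e; move: l_gt0; rewrite -e.
Qed.

Lemma pendant_blowup_connected : sg_connected G.
Proof.
have [c [rep [ca c6 _ cr]]] := reps.
pose r0 := rep 0%N; have c0 : c r0 = 0%N by rewrite cr.
have to0 u : connect (@adj G) u r0.
  have step w : c w != 0%N -> g10_adj (c w) 0 -> connect (@adj G) w r0.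
    by move=> _ w0; apply: connect1; rewrite ca c0.
  have := c6 u; case cu: (c u) => [|[|[|[|[|[|//]]]]]] _.
  - apply: (connect_trans (y := rep 1%N)); apply: connect1; rewrite ca ?cr // cu //.
  - by apply: connect1; rewrite ca cu c0.
  - by apply: connect1; rewrite ca cu c0.
  - by apply: connect1; rewrite ca cu c0.
  - apply: (connect_trans (y := rep 1%N)); apply: connect1; rewrite ca ?cr // cu //.
  - apply: (connect_trans (y := rep 3%N)); apply: connect1; rewrite ca ?cr // cu //.
move=> u w; apply: connect_trans (to0 u) _.
by rewrite (sym_connect_sym (@adj_sym G)).
Qed.

Lemma pendant_blowup_rank : graph_rank R G = 5.
Proof.
have [c [rep [ca c6 _ cr]]] := reps.
have cfg : pendant_triangle (rep 3%N) (rep 5%N) (rep 0%N) (rep 1%N) (rep 2%N).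
  by rewrite /pendant_triangle !ca !cr.
apply: (graph_rank_eq (h := tnth _) (pendant_triangle_nonsingular (R := R) cfg)) => u.
pose z (s : seq R) (j : 'I_5) := nth 0 s j.
pose B (w x : G) : R := (adj x w)%:R.
have E s w : \sum_j z s j * B w (tnth [tuple rep 3%N; rep 5%N; rep 0%N; rep 1%N; rep 2%N] j) =
    s`_0 * B w (rep 3%N) + s`_1 * B w (rep 5%N) + s`_2 * B w (rep 0%N)
    + s`_3 * B w (rep 1%N) + s`_4 * B w (rep 2%N).
  exact: big_tnth5.
have := c6 u; case cu: (c u) => [|[|[|[|[|[|//]]]]]] _.
- exists (z [:: 0; 0; 1; 0; 0]) => w; rewrite (E _ w) /B /= !ca cu !cr //; ring.
- exists (z [:: 0; 0; 0; 1; 0]) => w; rewrite (E _ w) /B /= !ca cu !cr //; ring.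
- exists (z [:: 0; 0; 0; 0; 1]) => w; rewrite (E _ w) /B /= !ca cu !cr //; ring.
- exists (z [:: 1; 0; 0; 0; 0]) => w; rewrite (E _ w) /B /= !ca cu !cr //; ring.
(* Class 4 has the neighbours of class 0 except class 3, the only neighbour of class 5. *)
- exists (z [:: 0; -1; 1; 0; 0]) => w; rewrite (E _ w) /B /= !ca cu !cr //.
  have := c6 w; case: (c w) => [|[|[|[|[|[|//]]]]]] _;
  by rewrite /g10_adj /= ?mulr1n ?mulr0n; ring.
- exists (z [:: 0; 1; 0; 0; 0]) => w; rewrite (E _ w) /B /= !ca cu !cr //; ring.
Qed.

Let n : R := #|G|%:R.

(** Summing the eigenvalue equation over the classes leaves two relations between [S 3] and
    [S 1 + S 2], with factors [capX] and [capZ]. *)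
Lemma pendant_blowup_radius (t := spectral_radius R G) :
  [/\ 0 < t, 0 < capX n t k%:R & capX n t k%:R * capZ t k%:R = 1].
Proof.
have G0 : (0 < #|G|)%N by rewrite pendant_blowup_card addn4.
have [x x0 xE] := perron R G0 pendant_blowup_connected.
have [c [rep [ca c6 cn cr]]] := reps.
pose S j := \sum_(u | c u == j) x u.
have S0 j : (j < 6)%N -> j != 4%N -> 0 < S j.
  move=> j6 j4; rewrite /S (bigD1 (rep j)) ?cr //= ltr_pwDl //.
  by apply: sumr_ge0 => w _; exact: ltW.
have nE u : nbr_sum x u = \sum_(j < 6) (g10_adj (c u) j)%:R * S j.
  rewrite nbr_sumE (partition_big (fun w => Ordinal (c6 w)) predT) //=.
  apply: eq_bigr => j _; rewrite /S mulr_sumr.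
  by apply: eq_big => [w|w /eqP <-]; rewrite ?ca // -val_eqE.
have SE j : (j < 6)%N -> t * S j =
    (nth 0%N [:: 1; 1; 1; 1; k; l] j)%:R * \sum_(i < 6) (g10_adj j i)%:R * S i.
  move=> j6; rewrite /S mulr_sumr -(cn _ j6) mulr_natl -sumr_const.
  by apply: eq_bigr => u /eqP <-; rewrite -xE nE.
have big6 (F : nat -> R) : \sum_(i < 6) F i =
    F 0%N + F 1%N + F 2%N + F 3%N + F 4%N + F 5%N.
  by rewrite !big_ord_recl big_ord0 addr0 !addrA.
have {}SE j : (j < 6)%N -> t * S j = (nth 0%N [:: 1; 1; 1; 1; k; l] j)%:R *
    ((g10_adj j 0%N)%:R * S 0%N + (g10_adj j 1%N)%:R * S 1%N
     + (g10_adj j 2%N)%:R * S 2%N + (g10_adj j 3%N)%:R * S 3%N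
     + (g10_adj j 4%N)%:R * S 4%N + (g10_adj j 5%N)%:R * S 5%N).
  by move=> /SE ->; rewrite (big6 (fun i => (g10_adj j i)%:R * S i)).
move: (SE 0%N isT) (SE 1%N isT) (SE 2%N isT) (SE 3%N isT) (SE 4%N isT) (SE 5%N isT).
rewrite /g10_adj /= !(mul0r, mul1r, add0r, addr0).
move: (S0 1%N isT isT) (S0 2%N isT isT) (S0 3%N isT isT) (S0 0%N isT isT).
move: (S 0%N) (S 1%N) (S 2%N) (S 3%N) (S 4%N) (S 5%N).
have -> : n = k%:R + l%:R + 4 by rewrite /n pendant_blowup_card !natrD.
move=> a b d i e f b0 d0 i0 a0 E0 E1 E2 E3 E4 E5.
have t0 : 0 < t by rewrite -(pmulr_lgt0 _ a0) E0 !addr_gt0.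
have Xi : capX (k%:R + l%:R + 4) t k%:R * i = b + d.
  have : t * (t * i) = t * (a + f) by rewrite E3.
  by rewrite mulrDr E0 E5 /capX; lra.
have Zs : capZ t k%:R * (b + d) = i.
  have : t * (t * b + t * d) = t * (a + d + e + (a + b + e)) by rewrite E1 E2.
  by rewrite /capZ; lra.
split=> //; first by rewrite -(pmulr_lgt0 _ i0) Xi addr_gt0.
have bd0 : b + d != 0 by rewrite gt_eqF // addr_gt0.
by apply: (mulIf bd0); rewrite mul1r -mulrA Zs.
Qed.

End PendantBlowup.

(** * Leaf frames as blowups *)

Section LeafCase.
Variables (R : realType) (G : sgraph).
Hypotheses (conG : sg_connected G) (rk5 : graph_rank R G = 5).
Variables (i v a b c : G).
Hypotheses (leaf : leaf_frame i v a b c) (ia : adj i a).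
Let t := spectral_radius R G.
Let cls := leaf_class v a b.
Let sz := class_size v a b.

Lemma card_leaf_classes : #|G| = (sz 0 + sz 1 + sz 2 + sz 3 + sz 4)%N.
Proof.
rewrite -sum1_card (partition_big (fun u => Ordinal (leaf_class_lt5 v a b u)) predT) //=.
rewrite !big_ord_recl big_ord0 addn0 !addnA.
by do 4?[congr (_ + _)%N]; rewrite sum1_card; apply: eq_card => u.
Qed.

Lemma leaf_case_blowup : sz 1 = 1%N -> sz 3 = 1%N -> sz 4 = 1%N ->
  (forall w, (1 < cls w)%N -> adj i w -> w = a) ->
  blowup_of (pendant_sizes (sz 2).-1 (sz 0)) G.
Proof.
move=> z1 z3 z4 only_a; have [cv ci ca cb cc] := leaf_class_frame leaf.
(* [a] is split off its part to become vertex 0; the rest of the part becomes vertex 4. *)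
pose code u : nat := if u == a then 0%N else nth 0%N [:: 5; 3; 4; 1; 2]%N (cls u).
have cls_lt5 u : (cls u < 5)%N := leaf_class_lt5 v a b u.
have code_lt6 u : (code u < 6)%N.
  by rewrite /code; case: eqP => // _; have := cls_lt5 u; case: (cls u) => [|[|[|[|[|]]]]].
have code0 u : cls u = 0%N -> code u = 5%N.
  by rewrite /code => cu; rewrite cu; case: eqP => // ua; rewrite /cls ua ca in cu.
have code1 u : cls u = 1%N -> code u = 3%N.
  by rewrite /code => cu; rewrite cu; case: eqP => // ua; rewrite /cls ua ca in cu.
have adj_i w : (1 < cls w)%N -> adj i w = (w == a).
  by move=> w1; apply/idP/eqP => [/(only_a _ w1)//|->].
exists (fun u => inord (code u)); split=> [j|u w]; last first.
  rewrite g10_adjE !inordK //.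
  case cu: (cls u) => [|[|ku]].
  - rewrite (adj_leaf_class0 conG rk5 leaf _ cu) (code0 _ cu) -/(cls w).
    case cw: (cls w) => [|[|kw]]; [by rewrite code0|by rewrite code1|].
    rewrite /code cw; case: (eqVneq w a) => // _; have := cls_lt5 w.
    by rewrite cw; case: kw {cw} => [|[|[|]]].
  - rewrite (adj_leaf_class1 leaf _ cu) (code1 _ cu).
    case cw: (cls w) => [|[|kw]].
    + by rewrite adj_sym (adj_leaf_class0 conG rk5 leaf _ cw) ci code0.
    + by rewrite adj_sym (adj_leaf_class1 leaf _ cw) adj_irrefl code1.
    + rewrite adj_i ?cw // /code cw; case: (eqVneq w a) => // _; have := cls_lt5 w.
      by rewrite cw; case: kw {cw} => [|[|[|]]].
  - case cw: (cls w) => [|[|kw]].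
    + rewrite adj_sym (adj_leaf_class0 conG rk5 leaf _ cw) -/(cls u) cu (code0 _ cw).
      rewrite /code cu; case: (eqVneq u a) => // _; have := cls_lt5 u.
      by rewrite cu; case: ku {cu} => [|[|[|]]].
    + rewrite adj_sym (adj_leaf_class1 leaf _ cw) adj_i ?cu // (code1 _ cw).
      rewrite /code cu; case: (eqVneq u a) => // _; have := cls_lt5 u.
      by rewrite cu; case: ku {cu} => [|[|[|]]].
    + rewrite (adj_leaf_class_parts conG rk5 leaf) -/(cls u) -/(cls w) ?cu ?cw //.
      rewrite /code cu cw; have := cls_lt5 u; have := cls_lt5 w; rewrite cu cw.
      have [ua|_] := eqVneq u a; have [wa|_] := eqVneq w a.
      * by move: cu cw; rewrite ua wa /cls ca => -[<-] [<-].
      * move: cu; rewrite ua /cls ca => -[<-].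
        by case: kw {cw} => [|[|[|]]].
      * move: cw; rewrite wa /cls ca => -[<-].
        by case: ku {cu} => [|[|[|]]].
      * by case: kw {cw} => [|[|[|]]]; case: ku {cu} => [|[|[|]]].
have fE : #|[pred u | inord (code u) == j]| = #|[pred u | code u == j]|.
  apply: eq_card => u; rewrite !inE -[LHS]val_eqE /= inordK //.
rewrite {}fE.
have szE m e : (forall u, (code u == e) = (cls u == m)) ->
    #|[pred u | code u == e]| = sz m.
  by move=> ce; apply: eq_card => u; rewrite !inE ce.
have codeE u : code u = if u == a then 0%N else nth 0%N [:: 5; 3; 4; 1; 2]%N (cls u) by [].
case: j => [[|[|[|[|[|[|//]]]]]] j6]; rewrite /pendant_sizes (tnth_nth 0%N) /=.
- rewrite -(card1 a); apply: eq_card => u; rewrite !inE codeE.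
  have := cls_lt5 u; case: (eqVneq u a) => // _.
  by case: (cls u) => [|[|[|[|[|]]]]].
- rewrite (szE 3%N) // => u; rewrite codeE; have := cls_lt5 u.
  have [->|_] := eqVneq u a; first by rewrite /cls ca.
  by case: (cls u) => [|[|[|[|[|]]]]].
- rewrite (szE 4%N) // => u; rewrite codeE; have := cls_lt5 u.
  have [->|_] := eqVneq u a; first by rewrite /cls ca.
  by case: (cls u) => [|[|[|[|[|]]]]].
- rewrite (szE 1%N) // => u; rewrite codeE; have := cls_lt5 u.
  have [->|_] := eqVneq u a; first by rewrite /cls ca.
  by case: (cls u) => [|[|[|[|[|]]]]].
- rewrite /sz /class_size [in RHS](cardD1 a) inE ca eqxx /=.
  apply: eq_card => u; rewrite !inE codeE -/(cls u); have := cls_lt5 u.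
  by case: (eqVneq u a) => //= _; case: (cls u) => [|[|[|[|[|]]]]].
- rewrite (szE 0%N) // => u; rewrite codeE; have := cls_lt5 u.
  have [->|_] := eqVneq u a; first by rewrite /cls ca.
  by case: (cls u) => [|[|[|[|[|]]]]].
Qed.

Lemma leaf_case_radius :
  (2 * #|G|%:R + 1 / 2 < 3 * t ^+ 2 - t /\ 27 / 2 < 3 * t ^+ 2 - t) \/
  exists k l : nat, [/\ (0 < l)%N, #|G| = (k + l + 4)%N, feasible #|G|%:R t k%:R
    & sfeasible #|G|%:R t k%:R \/ blowup_of (pendant_sizes k l) G].
Proof.
have [cv ci ca cb cc] := leaf_class_frame leaf.
have G0 : (0 < #|G|)%N by apply/card_gt0P; exists v.
have [x x0 xE] := perron R G0 conG.
have sys := leaf_frame_system conG rk5 leaf x0 xE ia; rewrite -/t -/sz in sys.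
have sz_gt0 u : (0 < sz (cls u))%N by apply/card_gt0P; exists u; rewrite inE.
have [z0 z1 z2 z3 z4] :
    [/\ 0 < sz 0, 0 < sz 1, 0 < sz 2, 0 < sz 3 & 0 < sz 4]%N.
  have := sz_gt0 v; have := sz_gt0 i; have := sz_gt0 a; have := sz_gt0 b.
  have := sz_gt0 c; rewrite /cls cv ci ca cb cc.
  by split.
have [small|large] := boolP [&& sz 1 == 1, sz 3 == 1 & sz 4 == 1]%N; last first.
  left; rewrite card_leaf_classes !natrD.
  apply: (leaf_system_gap sys).
    move: large; rewrite !negb_and; case: (leqP 2 (sz 1)) => [h _|h1 h].
      by left; move: h; rewrite -(ler_nat R); lra.
    right; have : (3 <= sz 3 + sz 4)%N.
      have s1 : sz 1%N = 1%N by apply/eqP; rewrite eqn_leq z1 -ltnS h1.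
      by move: h z3 z4; rewrite s1 /=; case: (sz 3%N) => [|[|?]]; case: (sz 4%N) => [|[|?]];
         rewrite ?addSn ?addnS.
    by rewrite -(ler_nat R) natrD; lra.
  case: (leqP 2 (sz 1)) => h; [right|left].
    by move: h; rewrite -(ler_nat R); lra.
  by have -> : sz 1%N = 1%N by apply/eqP; rewrite eqn_leq z1 -ltnS h.
case/and3P: small => /eqP s1 /eqP s3 /eqP s4; right.
have cG : #|G| = ((sz 2).-1 + sz 0 + 4)%N by rewrite card_leaf_classes s1 s3 s4; lia.
exists (sz 2).-1, (sz 0).
have pE : (sz 2)%:R = (sz 2).-1%:R + 1 :> R by rewrite natr1 prednK.
have nE : #|G|%:R = (sz 2).-1%:R + (sz 0)%:R + 4 :> R by rewrite cG !natrD.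
have one m : m = 1%N -> m%:R = 1 :> R by move=> ->.
have [X0 XZ strict] := leaf_system_pendant sys (one _ s1) (one _ s3) (one _ s4).
have XE : capX #|G|%:R t (sz 2).-1%:R = t ^+ 2 - (sz 0)%:R - 1.
  by rewrite /capX nE; ring.
have ZE : capZ t (sz 2).-1%:R = (t ^+ 2 - t) / 2 - (sz 2)%:R.
  by rewrite /capZ pE; ring.
split=> //; first by rewrite /feasible XE ZE X0 XZ.
(* A neighbour of [i] in the parts besides [a] makes the relation for class 1 strict; without one
   the graph is the blowup. *)
have [w /and3P[wa w1 iw]|no] :=
    pickP [pred w | [&& w != a, (1 < cls w)%N & adj i w]]; last first.
  right; apply: leaf_case_blowup => // w w1 iw; apply/eqP/negPn/negP => wa.
  by have := no w; rewrite /= wa w1 iw.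
left; rewrite /sfeasible XE ZE X0 /=; apply: strict.
have iS : x i <= class_sum v a b x 1%N.
  rewrite /class_sum (bigD1 i) ?ci //= lerDl.
  by apply: sumr_ge0 => u _; exact: ltW.
have t0 : 0 < t by case: sys.
apply: lt_le_trans (ler_wpM2l (ltW t0) iS).
pose P u := [|| cls u == 0%N, u == a | u == w].
have : \sum_(u | P u) x u <= t * x i.
  apply: (sum_le_nbr_sum x0 xE) => u /or3P[/eqP u0|/eqP->//|/eqP->//].
  by rewrite adj_sym (adj_leaf_class0 conG rk5 leaf _ u0) ci.
apply: lt_le_trans.
have w0 : cls w != 0%N by case: (cls w) w1.
rewrite (bigD1 w) /= ?/P ?eqxx ?orbT // (bigD1 a) /=; last first.
  by rewrite eqxx orbT eq_sym wa.
rewrite (_ : \sum_(u | _) x u = class_sum v a b x 0%N).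
  by have := x0 w; lra.
apply: eq_bigl => u; have [->|_] := eqVneq u a; first by rewrite /= andbF ca.
have [->|_] := eqVneq u w; first by rewrite andbF /= (negPf w0).
by rewrite !orbF !andbT.
Qed.

End LeafCase.

(** Unless [i] has a neighbour [z] in the parts, classes 0 and 1 are a union of components. This [z]
    replaces the triangle vertex of its part. *)
Lemma leaf_frame_attached (R : realType) (G : sgraph) (i v a b c : G) :
  sg_connected G -> graph_rank R G = 5 -> leaf_frame i v a b c ->
  exists i' v' a' b' c' : G, leaf_frame i' v' a' b' c' /\ adj i' a'.
Proof.
move=> conG rk5 leaf; have [cv ci ca cb cc] := leaf_class_frame leaf.
pose cls := leaf_class v a b.
have [z /andP[z1 iz]|no] := pickP [pred z | (1 < cls z)%N && adj i z]; last first.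
  pose A := [pred u | (cls u <= 1)%N].
  have cl : closed (@adj G) A.
    suff H u w : adj u w -> (cls u <= 1)%N -> (cls w <= 1)%N.
      by move=> u w uw; rewrite !inE; apply/idP/idP; apply: H => //; rewrite adj_sym.
    case cu: (cls u) => [|[|//]] uw _.
      by move: uw; rewrite (adj_leaf_class0 conG rk5 leaf _ cu) => /eqP; rewrite /cls => ->.
    move: uw; rewrite (adj_leaf_class1 leaf _ cu) leqNgt => iw.
    by apply/negP => w1; have := no w; rewrite /= w1 iw.
  have := closed_connect cl (conG v a).
  by rewrite !inE /cls cv ca.
case: (leaf) => /and5P[vi va vb vc /and3P[ab ac bc]] twin.
have vz : adj v z = false.
  by rewrite (adj_leaf_class0 conG rk5 leaf _ cv) -/(cls z); case: (cls z) z1 => [|[|]].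
have zp y : (1 < cls y)%N -> cls z != cls y -> adj z y.
  by move=> y1 zy; rewrite (adj_leaf_class_parts conG rk5 leaf).
have := leaf_class_lt5 v a b z; rewrite -/(cls z).
case cz: (cls z) z1 => [|[|[|[|[|//]]]]] // _ _.
- exists i, v, z, b, c; split=> //; split=> //.
  by rewrite /pendant_triangle vi vz vb vc bc !zp // /cls ?cb ?cc -/(cls z) ?cz.
- exists i, v, z, a, c; split=> //; split=> //.
  by rewrite /pendant_triangle vi vz va vc ac !zp // /cls ?ca ?cc -/(cls z) ?cz.
- exists i, v, z, a, b; split=> //; split=> //.
  by rewrite /pendant_triangle vi vz va vb ab !zp // /cls ?ca ?cb -/(cls z) ?cz.
Qed.

(** * Minimizers *)

Section Main.
Variable R : realType.

Lemma spectral_radius_gt0 (G : sgraph) : sg_connected G -> (1 < #|G|)%N ->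
  0 < spectral_radius R G.
Proof.
move=> conG G1; have [x x0 xE] := perron R (ltnW G1) conG.
case/card_gt1P: G1 => u [u' [_ _ uu']]; have [w uw] := has_nbr conG uu' u.
rewrite -(pmulr_lgt0 _ (x0 u)) -xE /nbr_sum (bigD1 w) //= ltr_pwDl //.
by apply: sumr_ge0 => y _; exact: ltW.
Qed.

(** From [(t - 5 / 2)^2 >= 0] follows [3 t^2 - t >= 14 t^2 / 5 - 5 / 4]. *)
Lemma gap_of_sqr_bound (n t : R) : 6 <= n -> 0 < t -> 4 * n + 3 <= 5 * t ^+ 2 ->
  2 * n + 1 / 2 < 3 * t ^+ 2 - t /\ 27 / 2 < 3 * t ^+ 2 - t.
Proof. by move=> n6 t0 tn; have := sqr_ge0 (t - 5 / 2); split; lra. Qed.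

(** Reduction to one parameter: some member of the family has radius at most [t], and less than [t]
    unless the graph is that member. *)
Lemma conn_rank5_feasible (n : nat) (G : sgraph) (t := spectral_radius R G) :
  (6 <= n)%N -> conn_rank5 R n G ->
  exists k l : nat, [/\ (0 < l)%N, n = (k + l + 4)%N, feasible n%:R t k%:R
    & sfeasible n%:R t k%:R \/ blowup_of (pendant_sizes k l) G].
Proof.
move=> n6 [cG conG rk5]; have G1 : (1 < #|G|)%N by rewrite cG; lia.
have t0 := spectral_radius_gt0 conG G1; rewrite -/t in t0.
have good : 2 * n%:R + 1 / 2 < 3 * t ^+ 2 - t /\ 27 / 2 < 3 * t ^+ 2 - t ->
  exists k l : nat, [/\ (0 < l)%N, n = (k + l + 4)%N, feasible n%:R t k%:R
    & sfeasible n%:R t k%:R \/ blowup_of (pendant_sizes k l) G].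
  case=> g1 g2; have [k kn sf] := sfeasible_exists n6 t0 g1 g2.
  exists k, (n - 4 - k)%N; split; [lia|lia| |by left].
  by case/andP: sf => X /ltW P; apply/andP.
have n6R : 6 <= n%:R :> R by rewrite ler_nat.
have sq : 4 * #|G|%:R + 3 <= 5 * t ^+ 2 ->
  exists k l : nat, [/\ (0 < l)%N, n = (k + l + 4)%N, feasible n%:R t k%:R
    & sfeasible n%:R t k%:R \/ blowup_of (pendant_sizes k l) G].
  by rewrite cG => sq; exact/good/gap_of_sqr_bound.
have [[s [us ss cov]]|[i [v [a [b [c cfg]]]]]] := five_hubs_or_frame conG rk5 G1.
  apply: sq; apply: (five_hubs R conG (ltnW G1) us ss cov).
  by rewrite cG; lia.
case: (pendant_triangle_bounded_or_leaf conG rk5 cfg) => [//|].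
move=> [i1 [v1 [a1 [b1 [c1 leaf1]]]]].
have [i' [v' [a' [b' [c' [leaf ia]]]]]] := leaf_frame_attached conG rk5 leaf1.
case: (leaf_case_radius conG rk5 leaf ia); rewrite -/t cG //.
Qed.

Lemma pendant_blowup_conn_rank5 (n k l : nat) (H : sgraph) :
  blowup_of (pendant_sizes k l) H -> (0 < l)%N -> n = (k + l + 4)%N ->
  conn_rank5 R n H.
Proof.
move=> bH l0 ->; split; first exact: pendant_blowup_card bH.
  exact: pendant_blowup_connected bH l0.
exact: pendant_blowup_rank bH l0.
Qed.

Lemma pendant_blowup_le (n k l : nat) (H : sgraph) (t : R) :
  blowup_of (pendant_sizes k l) H -> (0 < l)%N -> n = (k + l + 4)%N -> 0 < t ->
  (feasible n%:R t k%:R -> spectral_radius R H <= t) /\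
  (sfeasible n%:R t k%:R -> spectral_radius R H < t).
Proof.
move=> bH l0 nE t0; have [] := pendant_blowup_radius R bH l0.
rewrite (pendant_blowup_card bH) -nE => r0 X0 XZ.
have kn : 4 + k%:R < n%:R :> R by rewrite -natrD ltr_nat; lia.
split=> f; first exact: feasible_root_le XZ _ _ f.
exact: sfeasible_root_lt XZ _ _ f.
Qed.

(** Every competitor is feasible for some [j]. If [j = k], its radius is strictly larger unless it
    is the same blowup. *)
Lemma pendant_blowup_minimizer (n k l : nat) (H : sgraph) : (6 <= n)%N ->
  blowup_of (pendant_sizes k l) H -> (0 < l)%N -> n = (k + l + 4)%N ->
  (forall (j : nat) (t : R), j != k -> (j + 5 <= n)%N -> 0 < t ->
     feasible n%:R t j%:R -> spectral_radius R H < t) ->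
  the_minimizer R n H.
Proof.
move=> n6 bH l0 nE best; have HP := pendant_blowup_conn_rank5 bH l0 nE.
have key G : conn_rank5 R n G -> spectral_radius R H < spectral_radius R G \/
    (spectral_radius R H <= spectral_radius R G /\ sg_iso G H).
  move=> GP; have [j [m [m0 nE' fj sj]]] := conn_rank5_feasible n6 GP.
  have t0 : 0 < spectral_radius R G.
    by case: GP => cG conG _; apply: spectral_radius_gt0; rewrite ?cG //; lia.
  have [jk|jk] := eqVneq j k; last first.
    by left; apply: best fj => //; lia.
  have [le lt] := pendant_blowup_le bH l0 nE t0; rewrite jk in fj sj.
  case: sj => [/lt|bG]; [by left|right; split; first exact: le].
  have ml : m = l by lia.
  rewrite ml in bG; apply: (blowup_iso bG bH).
  by rewrite (pendant_blowup_card bH) addn4.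
split=> // G GP; first by case: (key G GP) => [/ltW|[]].
by move=> e; case: (key G GP) => [|[]//]; rewrite e ltxx.
Qed.

End Main.

(** * Order five: the pentagon *)

Section Pentagon.
Variable R : realType.

Definition g7_adj (j k : nat) : bool :=
  k \in nth [::] [:: [:: 1; 4]; [:: 0; 2]; [:: 1; 3]; [:: 2; 4]; [:: 3; 0]]%N j.

Lemma g7_adjE (j k : G7) : adj j k = g7_adj j k.
Proof. by case: j => [[|[|[|[|[|//]]]]] ?]; case: k => [[|[|[|[|[|//]]]]] ?]. Qed.

Lemma pentagon_iso (G : sgraph) (x0 : G) (s : seq G) :
  #|G| = 5%N -> uniq s -> size s = 5%N ->
  (forall j k, (j < 5)%N -> (k < 5)%N ->
    adj (nth x0 s j) (nth x0 s k) = g7_adj j k) ->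
  sg_iso G G7.
Proof.
move=> cG us ss sadj; have cs : #|s| = #|G| by rewrite (card_uniqP us) ss cG.
have mem_s x : x \in s by rewrite (subset_cardP cs (subset_predT _)).
have lt5 x : (index x s < 5)%N by rewrite -ss index_mem.
exists (fun x => inord (index x s) : G7) => [|x y].
  apply: inj_card_bij; last by rewrite card_ord cG.
  move=> x y /(congr1 val); rewrite /= !inordK // => xy.
  by rewrite -(nth_index x0 (mem_s x)) xy nth_index.
by rewrite g7_adjE !inordK // -sadj // !nth_index.
Qed.

Lemma G7_nbr_sum (u : G7) : nbr_sum (fun=> 1) u = 2 :> R.
Proof.
rewrite nbr_sumE; under eq_bigr do rewrite mulr1 g7_adjE.
rewrite !big_ord_recl big_ord0.
by case: u => [[|[|[|[|[|//]]]]] ?] /=; rewrite /g7_adj /=; ring.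
Qed.

Lemma G7_conn_rank5 : conn_rank5 R 5 G7.
Proof.
split; first exact: card_ord.
- pose o j : G7 := inord j.
  have step j : (j < 4)%N -> connect (@adj G7) (o j.+1) (o 0%N).
    elim: j => [|j IH] j4.
      by apply: connect1; rewrite g7_adjE /o !inordK.
    apply: connect_trans (IH (ltnW j4)); apply: connect1; rewrite g7_adjE /o !inordK //.
      by case: j j4 {IH} => [|[|[|]]].
    by rewrite ltnS ltnW.
  have to0 (u : G7) : connect (@adj G7) u (o 0%N).
    have -> : u = o u by rewrite /o inord_val.
    have := ltn_ord (u : 'I_5); case: (nat_of_ord u) => [|j]; first by rewrite connect0.
    exact: step.
  move=> u w; apply: connect_trans (to0 u) _.
  by rewrite (sym_connect_sym (@adj_sym G7)).
- have nd : nonsingular_on R (fun j : 'I_5 => j : G7).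
    move=> z zE; pose Z k := z (inord k).
    have E j : (j < 5)%N -> Z 0%N * (g7_adj 0 j)%:R + Z 1%N * (g7_adj 1 j)%:R
        + Z 2%N * (g7_adj 2 j)%:R + Z 3%N * (g7_adj 3 j)%:R + Z 4%N * (g7_adj 4 j)%:R = 0.
      move=> j5; rewrite -[RHS](zE (Ordinal j5)).
      under [RHS]eq_bigr => k _.
        rewrite g7_adjE -[k in z k]inord_val -/(Z k).
        over.
      by rewrite !big_ord_recl big_ord0 addr0 !addrA.
    have := E 0%N isT; have := E 1%N isT; have := E 2%N isT; have := E 3%N isT.
    have := E 4%N isT; rewrite /g7_adj /= => E4 E3 E2 E1 E0 j.
    rewrite -[j]inord_val -/(Z j).
    by have := ltn_ord j; case: (nat_of_ord j) => [|[|[|[|[|//]]]]] _; lra.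
  apply: (graph_rank_eq nd) => u.
  exists (fun j => (j == u :> 'I_5)%:R) => w.
  rewrite (bigD1 (u : 'I_5)) //= eqxx mul1r big1 ?addr0 // => j /negPf ->.
  by rewrite mul0r.
Qed.

(** The all-ones vector is an eigenvector for 2; pairing it with a Perron vector identifies the
    radius. *)
Lemma G7_radius : spectral_radius R G7 = 2.
Proof.
have [_ conG _] := G7_conn_rank5.
have G0 : (0 < #|G7|)%N by rewrite card_ord.
have [x x0 xE] := perron R G0 conG.
have S0 : 0 < \sum_u x u.
  rewrite (bigD1 (ord0 : 'I_5)) //= ltr_pwDl //.
  by apply: sumr_ge0 => u _; exact: ltW.
apply: (mulIf (lt0r_neq0 S0)).
rewrite mulr_sumr; under eq_bigr do rewrite -xE -[nbr_sum _ _]mul1r.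
rewrite (sum_nbr_sumC (fun=> 1)) mulr_sumr.
by apply: eq_bigr => u _; rewrite G7_nbr_sum.
Qed.

(** The degrees leave only the cycles [u a c d b] and [u a d c b]. *)
Lemma pentagon_of_degrees (G : sgraph) (u a b c d : G) : #|G| = 5%N ->
  uniq [:: u; a; b; c; d] ->
  (forall x, count (adj x) [:: u; a; b; c; d] = 2%N) ->
  adj u a -> adj u b -> sg_iso G G7.
Proof.
move=> cG us deg ua ub; have := deg u; have := deg a; have := deg b.
have := deg c; have := deg d; rewrite /= !adj_irrefl.
rewrite !(adj_sym _ u) !(adj_sym b a) !(adj_sym c a) !(adj_sym d a) !(adj_sym c b)
  !(adj_sym d b) !(adj_sym d c) ua ub.
case uc: (adj u c); case ud: (adj u d); case ab: (adj a b); case ac: (adj a c);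
  case ad: (adj a d); case bc: (adj b c); case bd: (adj b d);
  case cd: (adj c d) => //= _ _ _ _ _.
- apply: (@pentagon_iso _ u [:: u; a; c; d; b]) => //.
    rewrite -(perm_uniq (s1 := [:: u; a; b; c; d])) //.
    by apply/permP => P /=; ring.
  move=> [|[|[|[|[|//]]]]] [|[|[|[|[|//]]]]] _ _;
  by rewrite /= ?adj_irrefl ?(adj_sym _ u) ?(adj_sym b a) ?(adj_sym c a) ?(adj_sym d a)
    ?(adj_sym c b) ?(adj_sym d b) ?(adj_sym d c) ?ua ?ub ?uc ?ud ?ab ?ac ?ad ?bc ?bd ?cd.
- apply: (@pentagon_iso _ u [:: u; a; d; c; b]) => //.
    rewrite -(perm_uniq (s1 := [:: u; a; b; c; d])) //.
    by apply/permP => P /=; ring.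
  move=> [|[|[|[|[|//]]]]] [|[|[|[|[|//]]]]] _ _;
  by rewrite /= ?adj_irrefl ?(adj_sym _ u) ?(adj_sym b a) ?(adj_sym c a) ?(adj_sym d a)
    ?(adj_sym c b) ?(adj_sym d b) ?(adj_sym d c) ?ua ?ub ?uc ?ud ?ab ?ac ?ad ?bc ?bd ?cd.
Qed.

Lemma two_regular_iso (G : sgraph) (s : seq G) : #|G| = 5%N -> uniq s -> size s = 5%N ->
  (forall x, count (adj x) s = 2%N) -> sg_iso G G7.
Proof.
case: s => [|u [|a [|b [|c [|d [|]]]]]] // cG us _ deg.
have key a' b' c' d' : perm_eq [:: u; a; b; c; d] [:: u; a'; b'; c'; d'] ->
    adj u a' -> adj u b' -> sg_iso G G7.
  move=> pe ua ub; apply: (@pentagon_of_degrees G u a' b' c' d') => //.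
    by rewrite -(perm_uniq pe).
  by move=> x; rewrite -(permP pe).
have := deg u; rewrite /= adj_irrefl.
case ua: (adj u a); case ub: (adj u b); case uc: (adj u c); case ud: (adj u d) => //= _.
- by apply: (key a b c d) => //; apply/permP => P /=; ring.
- by apply: (key a c b d) => //; apply/permP => P /=; ring.
- by apply: (key a d b c) => //; apply/permP => P /=; ring.
- by apply: (key b c a d) => //; apply/permP => P /=; ring.
- by apply: (key b d a c) => //; apply/permP => P /=; ring.
- by apply: (key c d a b) => //; apply/permP => P /=; ring.
Qed.

Lemma feasible_5_gt2 (t : R) : 0 < t -> feasible 5 t 0 -> 2 < t.
Proof.
move=> t0 /andP[X0 P]; rewrite ltNge; apply/negP => t2.
have Z0 : 0 < capZ t 0 by rewrite -(pmulr_rgt0 _ X0) (lt_le_trans ltr01).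
have : 0 <= (2 - t) * (t + 1) by rewrite mulr_ge0; lra.
by move: Z0; rewrite /capZ; lra.
Qed.

Lemma gt2_of_sqr (t : R) : 0 < t -> 4 * 5 + 3 <= 5 * t ^+ 2 -> 2 < t.
Proof.
move=> t0 t5; rewrite ltNge; apply/negP => t2.
have : 0 <= (2 - t) * (2 + t) by rewrite mulr_ge0; lra.
by lra.
Qed.

Lemma gt2_of_cubic (t : R) : 0 < t -> 27 / 2 < 3 * t ^+ 2 - t -> 2 < t.
Proof.
move=> t0 t27; rewrite ltNge; apply/negP => t2.
have : 0 <= (2 - t) * (2 + t) by rewrite mulr_ge0; lra.
by lra.
Qed.

(** Five hubs are all the vertices here, so all degrees are at least 2; a frame gives [2 < t]. *)
Lemma conn_rank5_order5 (G : sgraph) (t := spectral_radius R G) :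
  conn_rank5 R 5 G -> 2 < t \/ (2 <= t /\ (t = 2 -> sg_iso G G7)).
Proof.
move=> [cG conG rk5]; have G1 : (1 < #|G|)%N by rewrite cG.
have t0 := spectral_radius_gt0 R conG G1; rewrite -/t in t0.
have [[s [us ss cov]]|[i [v [a [b [c cfg]]]]]] := five_hubs_or_frame conG rk5 G1.
  right; have [x x0 xE] := perron R (ltnW G1) conG; rewrite -/t in xE.
  have degE u : nbr_sum (fun=> 1) u = (count (adj u) s)%:R :> R.
    have cs : #|s| = #|G| by rewrite (card_uniqP us) ss cG.
    rewrite /nbr_sum sumr_const -size_filter -(card_uniqP _) ?filter_uniq //.
    congr (_%:R); apply: eq_card => w.
    by rewrite mem_filter (subset_cardP cs (subset_predT _)) andbT.
  have S0 : 0 < \sum_u x u.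
    have /card_gt0P[u _] := ltnW G1; rewrite (bigD1 u) //= ltr_pwDl //.
    by apply: sumr_ge0 => w _; exact: ltW.
  (* Pairing the degrees with the Perron vector: at [t = 2] every excess over degree 2 vanishes. *)
  have tS : \sum_u ((count (adj u) s)%:R - 2) * x u = (t - 2) * \sum_u x u.
    under eq_bigr do rewrite mulrBl.
    rewrite sumrB -mulr_sumr mulrBl; congr (_ - _).
    under eq_bigr do rewrite -degE.
    rewrite -(sum_nbr_sumC (fun=> 1)) mulr_sumr.
    by apply: eq_bigr => u _; rewrite mul1r xE.
  have term0 u : 0 <= ((count (adj u) s)%:R - 2) * x u.
    by rewrite mulr_ge0 ?(ltW (x0 u)) // subr_ge0 ler_nat.
  split.
    by rewrite -subr_ge0 -(pmulr_lge0 _ S0) -tS; apply: sumr_ge0.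
  move=> t2; apply: (two_regular_iso cG us ss) => u.
  have /eqP := tS; rewrite t2 subrr mul0r psumr_eq0 // => /allP/(_ u).
  rewrite mem_index_enum => /(_ isT); rewrite mulf_eq0 (gt_eqF (x0 u)) orbF.
  by rewrite subr_eq0 eqr_nat => /eqP.
left; case: (pendant_triangle_bounded_or_leaf conG rk5 cfg).
  by rewrite cG -/t; exact: gt2_of_sqr.
move=> [i1 [v1 [a1 [b1 [c1 leaf1]]]]].
have [i' [v' [a' [b' [c' [leaf ia]]]]]] := leaf_frame_attached conG rk5 leaf1.
case: (leaf_case_radius conG rk5 leaf ia); rewrite -/t cG.
  by case=> _; exact: gt2_of_cubic.
move=> [k [l [l0 kl f _]]]; have k0 : k = 0%N by lia.
by apply: feasible_5_gt2 => //; rewrite k0 in f.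
Qed.

Lemma order5_minimizer : the_minimizer R 5 G7.
Proof.
split; first exact: G7_conn_rank5.
  by move=> G /conn_rank5_order5; rewrite G7_radius => -[/ltW|[]].
move=> G /conn_rank5_order5; rewrite G7_radius => -[t2 e|[_]//].
by rewrite e ltxx in t2.
Qed.

End Pentagon.

Theorem theorem2 (R : realType) (n : nat) (n_ge5 : (5 <= n)%N) :
  [/\ n = 5%N -> the_minimizer R n G7,
      (6 <= n <= 10)%N ->
        the_minimizer R n (multiply G1 (tnth [tuple 1; 1; 1; 1; n - 4]%N)),
      n = 11%N ->
        the_minimizer R n (multiply G10 (tnth [tuple 1; 1; 1; 1; 1; n - 5]%N))
    & (12 <= n)%N ->
        exists2 k : nat,
          k%:Z = Num.floor (alpha R n) \/ k%:Z = Num.ceil (alpha R n) &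
          the_minimizer R n
            (multiply G10 (tnth [tuple 1; 1; 1; 1; k; n - k - 4]%N))].
Proof.
split.
- by move=> ->; exact: order5_minimizer.
- move=> n610; have [n6 n10] := andP n610; have bH := G1_blowup (n - 4).
  have l0 : (0 < n - 4)%N by lia.
  have nE : n = (0 + (n - 4) + 4)%N by lia.
  apply: (pendant_blowup_minimizer n6 bH l0 nE) => j t j0 jn t0 fj.
  have [_] := pendant_blowup_le bH l0 nE t0; apply.
  by apply: best_k_le10 fj => //; rewrite lt0n.
- move=> n11; have bH := multiply_blowup (pendant_sizes 1 (n - 5)).
  have l0 : (0 < n - 5)%N by lia.
  have nE : n = (1 + (n - 5) + 4)%N by lia.
  apply: (pendant_blowup_minimizer _ bH l0 nE) => [|j t j0 jn t0 fj]; first by lia.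
  have [_] := pendant_blowup_le bH l0 nE t0; apply.
  by rewrite n11 in fj *; apply: best_k_11 fj.
move=> n12; have [f [c [fl ce cn fc best]]] := best_k_ge12 R n12.
have n6 : (6 <= n)%N by lia.
pose H k := multiply G10 (pendant_sizes k (n - k - 4)).
have bH k : blowup_of (pendant_sizes k (n - k - 4)) (H k) by exact: multiply_blowup.
have l0 k : (k + 5 <= n)%N -> (0 < n - k - 4)%N by lia.
have nE k : (k + 5 <= n)%N -> n = (k + (n - k - 4) + 4)%N by lia.
have rad k t : (k + 5 <= n)%N -> 0 < t ->
    (feasible n%:R t k%:R -> spectral_radius R (H k) <= t) /\
    (sfeasible n%:R t k%:R -> spectral_radius R (H k) < t).
  by move=> kn t0; exact: pendant_blowup_le (bH k) (l0 k kn) (nE k kn) t0.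
have min k : (k + 5 <= n)%N -> (forall (j : nat) (t : R), j != k -> (j + 5 <= n)%N ->
    0 < t -> feasible n%:R t j%:R -> spectral_radius R (H k) < t) ->
    the_minimizer R n (H k).
  by move=> kn; exact: pendant_blowup_minimizer n6 (bH k) (l0 k kn) (nE k kn).
have fn : (f + 5 <= n)%N by lia.
(* Every other multiplicity loses to the floor or to the ceiling of [alpha]. *)
have side (j : nat) (t : R) : j != f -> j != c -> 0 < t -> feasible n%:R t j%:R ->
    spectral_radius R (H f) < t \/ spectral_radius R (H c) < t.
  move=> jf jc t0 fj; have [lo hi] := best j t t0 fj.
  have [jltf|fltj] := ltnP j f; [left|right].
    by have [_] := rad f t fn t0; apply; exact: lo.
  by have [_] := rad c t cn t0; apply; apply: hi; lia.
case: fc => [cf|cf].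
  exists f; first by left.
  apply: min => // j t jf jn t0 fj.
  by case: (side j t jf _ t0 fj); rewrite ?cf.
have [] := pendant_blowup_radius R (bH f) (l0 f fn).
have [] := pendant_blowup_radius R (bH c) (l0 c cn).
rewrite !(pendant_blowup_card (bH _)) -!nE //.
set rf := spectral_radius R (H f); set rc := spectral_radius R (H c).
move=> rc0 Xc Pc rf0 Xf Pf.
have feas_rf : feasible n%:R rf f%:R by rewrite /feasible Xf Pf lexx.
have feas_rc : feasible n%:R rc c%:R by rewrite /feasible Xc Pc lexx.
(* Equal radii would make the products at two consecutive multiplicities equal to 1 at the same
   [t]. *)
have rfc : rf != rc.
  apply/eqP => e; apply: (caps_no_tie rf0 Xf Pf).
  by rewrite natr1 -cf e.
case: (ltgtP rf rc) rfc => // [lt|lt] _.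
- exists f; first by left.
  apply: min => // j t jf jn t0 fj; have [jc|jc] := eqVneq j c.
    apply: lt_le_trans lt _; have [le _] := rad c t cn t0.
    by apply: le; rewrite -jc.
  by case: (side j t jf jc t0 fj) => // /(lt_trans lt).
- exists c; first by right.
  apply: min => // j t jc jn t0 fj; have [jf|jf] := eqVneq j f.
    apply: lt_le_trans lt _; have [le _] := rad f t fn t0.
    by apply: le; rewrite -jf.
  by case: (side j t jf jc t0 fj) => // /(lt_trans lt).
Qed.
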